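(* Let $p>3/2$ and let $-1<k<1/2$. Let $D\subset L^p(B)$ be the set of spherically symmetric, non-negative, decreasing densities of mass one on the unit ball $B\subset\mathbb{R}^3$, and let $T\colon D\to D$ be the mass-preserving operator with exponent $k$ and cut-off energy $-1$ (both defined in the context). Then $T$ has a fixed point, i.e. there exists $\rho^\ast\in D$ with $T(\rho^\ast)=\rho^\ast$. In particular, the Vlasov-Poisson system has a steady state given by the polytropic ansatz up to a positive multiplicative constant: there exist a constant $A>0$ and a density $\rho^\ast\in D$ (extended by $0$ to $\mathbb{R}^3$) such that, with $$U^\ast(x)=U_{\rho^\ast}(x)=-\int_{\mathbb{R}^3}\frac{\rho^\ast(y)}{|x-y|}\,dy,\qquad f^\ast(x,v)=A\left(-1-\tfrac12|v|^2-U^\ast(x)\right)_+^k ,$$ the triple $(f^\ast,\rho^\ast,U^\ast)$ is a steady state of the Vlasov-Poisson system.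
   Context: Notation. $B=B_1(0)$ is the open unit ball in $\mathbb{R}^3$ centered at the origin. A function on $B$ is spherically symmetric if it depends only on $r=|x|$ (almost everywhere); one writes $\rho(x)=\rho(r)$. For elements of $L^p(B)$, ''decreasing'' means that some representative is non-increasing as a function of $r$. For $a\in\mathbb{R}$ and real $k$, $a_+^k=a^k$ if $a>0$ and $a_+^k=0$ if $a\le 0$. The set $D$. For $p>3/2$, $$D=\Big\{\rho\in L^p(B) : \rho\ge 0 \text{ is spherically symmetric and decreasing with } \int_B\rho\,dx=1\Big\}.$$ Elements of $D$ are extended by $0$ to $\mathbb{R}^3$. The potential. For $\rho\in D$, $$U_\rho(x)=-\int_{\mathbb{R}^3}\frac{\rho(y)}{|x-y|}\,dy=-\frac{4\pi}{r}\int_0^r\rho(s)\,s^2\,ds-4\pi\int_r^\infty\rho(s)\,s\,ds,\qquad r=|x|,$$ which is continuous (as $p>3/2$), increasing in $r$, and satisfies $U_\rho=-1$ on $\partial B$. The operator $T$. For $k>-1$ and $\rho\in D$ set $$\tilde\rho(x)=\int_{\mathbb{R}^3}\left(-1-\tfrac12|v|^2-U_\rho(x)\right)_+^k dv=c_k\left(-1-U_\rho(x)\right)_+^{k+3/2},\qquad c_k=4\pi\sqrt2\int_0^1\eta^k\sqrt{1-\eta}\,d\eta,$$ $$A(\tilde\rho)=\left(\int_B\tilde\rho(x)\,dx\right)^{-1},\qquad T(\rho)=A(\tilde\rho)\,\tilde\rho .$$ Then $T(\rho)\in D$. Steady states. The stationary Vlasov-Poisson system is $v\cdot\nabla_x f-\nabla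 U\cdot\nabla_v f=0$, $\Delta U=4\pi\rho$, $\lim_{|x|\to\infty}U(x)=0$, $\rho(x)=\int_{\mathbb{R}^3}f(x,v)\,dv$. A triple $(f,\rho,U)$ with $f=\Phi(E)$ a function of the particle energy $E=\frac12|v|^2+U(x)$, $\rho=\int f\,dv$ and $U=U_\rho$ is a steady state: the Vlasov equation is understood in the sense that $f$ is constant along the characteristics $\dot x=v$, $\dot v=-\nabla U(x)$, along which $E$ is conserved. *)

(* Defs.v *)
From HB Require Import structures.
From mathcomp Require Import all_boot all_order all_algebra.
From mathcomp Require Import all_classical all_reals all_analysis.
Set Implicit Arguments.
Unset Strict Implicit.
Unset Printing Implicit Defensive.
Import Order.TTheory GRing.Theory Num.Theory.
Import numFieldNormedType.Exports.
Local Open Scope classical_set_scope.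
Local Open Scope ring_scope.

(** [R * R * R] carries the product (Borel) sigma-algebra, the product Lebesgue
    measure and the normed structure used for differentiation. Its library norm
    is the sup norm, hence the separate Euclidean norm [enorm]. *)
Definition enorm (R : realType) (x : R * R * R) : R :=
  Num.sqrt (x.1.1 ^+ 2 + x.1.2 ^+ 2 + x.2 ^+ 2).

Definition leb3 (R : realType) :
    {measure set (measurableTypeR R * measurableTypeR R * measurableTypeR R)
       -> \bar R} :=
  (((@lebesgue_measure R) \x (@lebesgue_measure R))
     \x (@lebesgue_measure R))%E.

Definition unit_ball3 (R : realType) : set (R * R * R) :=
  [set x | enorm x < 1].

Definition pos_pow (R : realType) (a k : R) : R :=
  if 0 < a then a `^ k else 0.

(** An element of [L^p(B)] is given by a representative on the whole space that
    vanishes outside [B]. The profile [g] is real valued but only required to be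
    monotone on the open interval: its value at 0 is irrelevant, so that [rho]
    may be unbounded near the origin. *)
Definition densities (R : realType) (p : R) : set (R * R * R -> R) :=
  [set rho | [/\ rho \in Lfun (leb3 R) p%:E,
      (forall x, ~ unit_ball3 x -> rho x = 0),
      {ae leb3 R, forall x, 0 <= rho x},
      (exists g : R -> R,
         {in `]0, 1[ &, {homo g : r s / r <= s >-> s <= r}} /\
         {ae leb3 R, forall x, unit_ball3 x -> rho x = g (enorm x)})
    & (\int[leb3 R]_(x in unit_ball3 (R := R)) (rho x)%:E = 1)%E]].

(** At [y = x] the integrand is [0] because [0^-1 = 0]; this is a null set. *)
Definition potential (R : realType) (rho : R * R * R -> R) (x : R * R * R) : R :=
  - \int[leb3 R]_y (rho y / enorm (x - y)).

Definition polytrope (R : realType) (k : R) (U : R * R * R -> R)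
    (x v : R * R * R) : R :=
  pos_pow (- 1 - 2^-1 * enorm v ^+ 2 - U x) k.

Definition induced_density (R : realType) (k : R) (rho : R * R * R -> R)
    (x : R * R * R) : R :=
  \int[leb3 R]_v polytrope k (potential rho) x v.

Definition T_op (R : realType) (k : R) (rho : R * R * R -> R)
    (x : R * R * R) : R :=
  (\int[leb3 R]_(y in unit_ball3 (R := R)) induced_density k rho y)^-1
  * induced_density k rho x.

Definition e1 (R : realType) : R * R * R := (1, 0, 0).
Definition e2 (R : realType) : R * R * R := (0, 1, 0).
Definition e3 (R : realType) : R * R * R := (0, 0, 1).

Definition gradient (R : realType) (U : R * R * R -> R) (x : R * R * R) :
    R * R * R :=
  ('D_(e1 R) U x, 'D_(e2 R) U x, 'D_(e3 R) U x).

Definition laplacian (R : realType) (U : R * R * R -> R) (x : R * R * R) : R :=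
  'D_(e1 R) ('D_(e1 R) U) x + 'D_(e2 R) ('D_(e2 R) U) x
  + 'D_(e3 R) ('D_(e3 R) U) x.

Definition twice_differentiable (R : realType) (U : R * R * R -> R) : Prop :=
  forall x, differentiable U x /\
    [/\ differentiable ('D_(e1 R) U) x, differentiable ('D_(e2 R) U) x
      & differentiable ('D_(e3 R) U) x].

Definition characteristic (R : realType) (U : R * R * R -> R) (a b : R)
    (X V : R -> R * R * R) : Prop :=
  forall t, t \in `]a, b[ ->
    is_derive t 1 X (V t) /\ is_derive t 1 V (- gradient U (X t)).

(** The Vlasov equation is meant along characteristics, on any open time
    interval, since [f] need not be differentiable. *)
Definition vlasov (R : realType) (f : R * R * R -> R * R * R -> R)
    (U : R * R * R -> R) : Prop :=
  forall a b X V, characteristic U a b X V ->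
    {in `]a, b[ &, forall s t, f (X s) (V s) = f (X t) (V t)}.

Definition vanishes_at_infinity (R : realType) (U : R * R * R -> R) : Prop :=
  forall e, 0 < e -> exists M, forall x, M < enorm x -> `|U x| < e.

Definition particle_energy (R : realType) (U : R * R * R -> R)
    (x v : R * R * R) : R :=
  2^-1 * enorm v ^+ 2 + U x.

(** All equations hold pointwise for the given functions, so [rho] has to be the
    representative defined by the integral of [f]. *)
Definition steady_state (R : realType) (f : R * R * R -> R * R * R -> R)
    (rho U : R * R * R -> R) : Prop :=
  [/\ (exists Phi : R -> R, forall x v, f x v = Phi (particle_energy U x v)),
      vlasov f U,
      (forall x, (\int[leb3 R]_v (f x v)%:E = (rho x)%:E)%E),
      U = potential rho
    & [/\ twice_differentiable U,
          (forall x, laplacian U x = 4 * pi * rho x)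
        & vanishes_at_infinity U]].

(* Main.v *)
(** In the variable [q = |x|^2], a radial density [beta * G (|x|^2)] creates, by
    Archimedes' hat-box theorem, the potential
    [c0 + 2 pi beta * V G (|x|^2)], where
    [V G Q = \int_0^Q (1 - sqrt (q / Q)) G q dq]. The fixed-point equation of
    [T] thereby becomes the Lane-Emden equation [b = 1 - V (b_+^n)] with
    [n = k + 3/2] in (1/2, 2). As [V] is monotone, [b |-> 1 - V (b_+^n)] is antitone, and
    the least pre-fixed point of its square starts a two-cycle, which is a
    fixed point by Gronwall as long as it is positive. As [n < 2], it cannot remain
    positive; rescaling its first zero to [|x| = 1] gives the fixed point, and an
    amplitude turns it into the steady state. Conservation of energy along
    characteristics is the Vlasov equation, and differentiating
    [V G (|x|^2)] twice gives the Poisson equation. *)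
Require Import Defs.
From HB Require Import structures.
From mathcomp Require Import all_boot all_order all_algebra.
From mathcomp Require Import all_classical all_reals all_analysis.
From mathcomp Require Import measurable_realfun.
From mathcomp Require Import ring lra.
Set Implicit Arguments.
Unset Strict Implicit.
Unset Printing Implicit Defensive.
Import Order.TTheory GRing.Theory Num.Theory.
Import numFieldNormedType.Exports.
Local Open Scope classical_set_scope.
Local Open Scope ring_scope.

(** * Radial integrals in space *)

(** The exponent n may be below 1, and then the truncated power has infinite slope at 0: a Picard
    iteration loses control exactly where the density vanishes. Existence is therefore taken from
    order alone, and a Lipschitz estimate is used only where the solution stays away from 0.
    Monotone functions suit this: monotonicity survives pointwise infima and gives measurability,
    while continuity comes back after one application of the integral operator. Nothing is lost by
    solving with central value 1. Stretching q moves the first zero to 1, and the mass then fixes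
    the central density. Mass one in the unit ball makes the potential -1 on the sphere, so the
    cut-off energy truncates exactly at that zero. The constant that remains is cancelled by the
    normalisation in [T_op] and returns as the amplitude of the steady state. The variable q is used
    because |x|^2 is a polynomial: it is smooth at the origin, so that only the profile needs care
    there, and spatial integrals reduce to Tonelli, affine substitutions and rotations. *)

Lemma ge0_integral_affine (R : realType) (a b : R)
    (f : R -> \bar R) :
  0 < a -> measurable_fun [set: R] f -> (forall x, (0 <= f x)%E) ->
  (a%:E * \int[@lebesgue_measure R]_x f (a * x + b)%R
    = \int[@lebesgue_measure R]_x f x)%E.
Proof.
move=> a0 mf f0.
pose phi : measurableTypeR R -> measurableTypeR R := fun x => a * x + b.
have mphi : measurable_fun [set: measurableTypeR R] phi.
  by apply: measurable_funD => //; exact: measurable_funM.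
pose m0 : {measure set (measurableTypeR R) -> \bar R} :=
  mscale (NngNum (ltW a0)) (pushforward (@lebesgue_measure R) phi).
pose m := m0 mphi.
(* By uniqueness of Lebesgue measure it is enough to compare the two measures on half-open
   intervals. *)
have mE A : measurable A -> lebesgue_measure A = m A.
  apply: lebesgue_measure_unique => _ [[c d]] _ <-.
  rewrite [RHS](_ : _ = a%:E * lebesgue_measure (phi @^-1` `]c, d]))%E//.
  have -> : phi @^-1` `]c, d] = `](c - b) / a, (d - b) / a]%classic.
    apply/seteqP; split => x /=; rewrite /phi !in_itv/= ltr_pdivrMr//
      ler_pdivlMr// ltrBlDr lerBrDr mulrC //.
  rewrite !lebesgue_measure_itv/= !lte_fin ltr_pM2r ?invr_gt0// ltrD2r.
  case: ifP => _; last by rewrite mule0.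
  rewrite -!EFinB -EFinM; congr (_%:E); field; lra.
rewrite [RHS](eq_measure_integral m); last by move=> A mA _; exact: mE.
rewrite ge0_integral_mscale//= ge0_integral_pushforward//.
Qed.

(** * Area of the disc and polar integration in the plane *)

Section disc.
Variable R : realType.
Local Notation mu := (@lebesgue_measure R).

(** The substitution x = s sin u is strictly increasing only for s > 0, hence the separate
    degenerate case. *)
Lemma integral_half_disc (s : R) : 0 <= s ->
  (\int[mu]_(x in `[(- s)%R, s]) (Num.sqrt (s ^+ 2 - x ^+ 2))%:E
    = (pi * s ^+ 2 / 2)%:E)%E.
Proof.
rewrite le_eqVlt => /predU1P[<-|s0].
  by rewrite oppr0 set_itv1 integral_set1 expr0n/= mulr0 mul0r.
pose F : R -> R := fun u => s * sin u.
have Fpi : F (pi / 2) = s by rewrite /F sin_pihalf mulr1.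
have FNpi : F (- (pi / 2)) = - s by rewrite /F sinN sin_pihalf mulrN1.
have pi2 : - (pi / 2) < pi / 2 :> R by rewrite gtrN// divr_gt0// pi_gt0.
have dF (x : R) : is_derive x 1 F (s * cos x).
  by apply: is_deriveZ.
have F'E : (derive1 F) = fun x => s * cos x.
  by apply/funext => x; rewrite derive1E; apply: derive_val.
have cF : continuous F.
  by move=> x; apply: cvgM; [exact: cvg_cst|exact: continuous_sin].
have cF' : continuous (derive1 F).
  by rewrite F'E => x; apply: cvgM; [exact: cvg_cst|exact: continuous_cos].
transitivity (\int[mu]_(x in `[F (- (pi / 2))%R, F (pi / 2)%R])
    (Num.sqrt (s ^+ 2 - x ^+ 2))%:E)%E; first by rewrite Fpi FNpi.
rewrite (@integration_by_substitution_increasing R F); first last.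
- apply: continuous_subspaceT => x.
  apply: (@continuous_comp R R R (fun x => s ^+ 2 - x ^+ 2) Num.sqrt).
    apply: cvgB; first exact: cvg_cst.
    exact: exprn_continuous.
  exact: sqrt_continuous.
- split.
  + by move=> x _; exact: ex_derive.
  + by apply: cvg_at_right_filter; exact: cF.
  + by apply: cvg_at_left_filter; exact: cF.
- by apply/cvg_ex; exists ((derive1 F) (pi/2)); apply: cvg_at_left_filter; exact: cF'.
- by apply/cvg_ex; exists ((derive1 F) (-(pi/2))); apply: cvg_at_right_filter; exact: cF'.
- by move=> x _; exact: cF'.
- move=> x y xI yI xy; rewrite /F ltr_pM2l// ltr_sin//.
- exact: ltW.
(* A primitive of s^2 cos^2 u. *)
pose G : R -> R := fun u => s ^+ 2 / 2 * (u + sin u * cos u).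
have dG (x : R) : is_derive x 1 G (s ^+ 2 * cos x ^+ 2).
  apply: is_derive_eq; rewrite /GRing.scale /=.
  have := cos2Dsin2 x; nra.
transitivity (\int[mu]_(x in `[(- (pi / 2))%R, (pi / 2)%R])
   (s ^+ 2 * cos x ^+ 2)%:E)%E.
  apply: eq_integral => x /[!inE] /= xI; congr (_%:E).
  rewrite F'E.
  change (Num.sqrt (s ^+ 2 - (s * sin x) ^+ 2) * (s * cos x) = s ^+ 2 * cos x ^+ 2).
  have -> : s ^+ 2 - (s * sin x) ^+ 2 = (s * cos x) ^+ 2.
    by have := cos2Dsin2 x; nra.
  rewrite sqrtr_sqr ger0_norm; first by ring.
  by rewrite mulr_ge0 ?(ltW s0)// cos_ge0_pihalf//; move: xI; rewrite in_itv.
rewrite (@continuous_FTC2 R _ G)//.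
- rewrite -EFinB; congr (_%:E).
  by rewrite /G sinN cosN cos_pihalf; field.
- apply: continuous_subspaceT => x; apply: cvgM; first exact: cvg_cst.
  by under eq_cvg do rewrite expr2; apply: cvgM; exact: continuous_cos.
- have cG : continuous G.
    by move=> x; apply/differentiable_continuous/derivable1_diffP.
  split.
  + by move=> x _; exact: ex_derive.
  + by apply: cvg_at_right_filter; exact: cG.
  + by apply: cvg_at_left_filter; exact: cG.
- by move=> x _; rewrite derive1E; apply: derive_val.
Qed.

End disc.

Lemma measurable_fun_sqrt d (T : measurableType d) (R : realType) (D : set T)
    (f : T -> R) :
  measurable_fun D f -> measurable_fun D (fun x => Num.sqrt (f x)).
Proof.
move=> mf; apply: (measurableT_comp _ mf).
by apply: continuous_measurable_fun; exact: sqrt_continuous.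
Qed.

Section plane.
Variable R : realType.
Local Notation mu := (@lebesgue_measure R).
Let P := (measurableTypeR R * measurableTypeR R)%type.
Let sqn (w : P) : measurableTypeR R := w.1 ^+ 2 + w.2 ^+ 2.

Let msqn : measurable_fun [set: P] sqn.
Proof.
by apply: measurable_funD; apply: measurable_funX; [exact: measurable_fst|exact: measurable_snd].
Qed.

Lemma measure_disc (t : R) : 0 <= t ->
  (mu \x mu)%E [set w : P | w.1 ^+ 2 + w.2 ^+ 2 <= t] = (pi * t)%:E.
Proof.
move=> t0.
have mD : measurable [set w : P | w.1 ^+ 2 + w.2 ^+ 2 <= t].
  have -> : [set w : P | w.1 ^+ 2 + w.2 ^+ 2 <= t] = sqn @^-1` `]-oo, t].
    by apply/seteqP; split => w /=; rewrite in_itv.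
  by rewrite -[X in measurable X]setTI; exact: msqn.
rewrite /product_measure1 /=.
have xs (x : R) : xsection [set w : P | w.1 ^+ 2 + w.2 ^+ 2 <= t] x =
    [set y : R | y ^+ 2 <= t - x ^+ 2].
  by apply/seteqP; split => y; rewrite /xsection /= inE /= lerBrDl.
set s := Num.sqrt t.
have s0 : 0 <= s by exact: sqrtr_ge0.
have s2 : s ^+ 2 = t by rewrite sqr_sqrtr.
transitivity (\int[mu]_(x in `[(- s)%R, s]) (2 * Num.sqrt (s ^+ 2 - x ^+ 2))%:E)%E; last first.
  under eq_integral do rewrite EFinM.
  rewrite ge0_integralZl_EFin//.
  - by rewrite integral_half_disc// -EFinM -s2; congr (_%:E); field.
  - apply/measurable_EFinP; apply: measurable_funTS.
    by apply: measurable_fun_sqrt; apply: measurable_funB => //; exact: measurable_funX.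
rewrite [RHS]integral_mkcond; apply: eq_integral => x _ /=.
rewrite [X in mu X]xs patchE; case: ifPn => [|]; rewrite ?mem_setE in_itv/= -ler_norml.
  move=> xs'; have x2 : x ^+ 2 <= t.
    by rewrite -s2 -[x ^+ 2]real_normK ?num_real// ler_sqr// nnegrE ltW.
  have -> : [set y : R | y ^+ 2 <= t - x ^+ 2] =
     `[(- Num.sqrt (t - x ^+ 2))%R, Num.sqrt (t - x ^+ 2)]%classic.
    apply/seteqP; split => y /=; rewrite in_itv/= -ler_norml => yx.
      by rewrite -sqrtr_sqr ler_sqrt// subr_ge0.
    by move: yx; rewrite -sqrtr_sqr ler_sqrt// subr_ge0.
  rewrite lebesgue_measure_itv/= lte_fin s2; case: ltP => [_|].
    by rewrite -EFinB; congr (_%:E); ring.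
  by rewrite -subr_ge0 => h; congr (_%:E); have := sqrtr_ge0 (t - x ^+ 2); lra.
move=> xs'; have -> : [set y : R | y ^+ 2 <= t - x ^+ 2] = set0.
  apply/seteqP; split => // y /= yx; move: xs' => /negP; apply.
  rewrite -sqrtr_sqr ler_sqrt//; have := sqr_ge0 y; lra.
by rewrite measure0.
Qed.

Lemma measure_annulus (a b : R) : 0 <= a -> a <= b ->
  (mu \x mu)%E (sqn @^-1` `]a, b]) = (pi * (b - a))%:E.
Proof.
move=> a0 ab.
have mD (t : R) : measurable [set w : P | w.1 ^+ 2 + w.2 ^+ 2 <= t].
  have -> : [set w : P | w.1 ^+ 2 + w.2 ^+ 2 <= t] = sqn @^-1` `]-oo, t].
    by apply/seteqP; split => w /=; rewrite in_itv.
  by rewrite -[X in measurable X]setTI; exact: msqn.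
have -> : sqn @^-1` `]a, b] =
    [set w : P | w.1 ^+ 2 + w.2 ^+ 2 <= b] `\` [set w : P | w.1 ^+ 2 + w.2 ^+ 2 <= a].
  apply/seteqP; split => w /=; rewrite in_itv/=.
    by case/andP=> h1 h2; split => //; apply/negP; rewrite -ltNge.
  by case=> h1 /negP; rewrite -ltNge => h2; rewrite h2.
have lty : ((mu \x mu)%E [set w : P | (w.1 ^+ 2 + w.2 ^+ 2 <= b)%R] < +oo)%E.
  by rewrite measure_disc ?ltry// (le_trans a0).
rewrite measureD//.
rewrite setIidr; last by move=> w /= h; exact: le_trans h ab.
transitivity ((pi * b)%:E - (pi * a)%:E)%E.
  by congr (_ - _)%E; apply: measure_disc => //; exact: le_trans ab.
by rewrite -EFinB; congr (_%:E); ring.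
Qed.

(** Polar coordinates without angles: an annulus has area pi times its increment of squared radius,
    so the image of plane Lebesgue measure under the squared norm is pi dq on the half line. *)
Lemma ge0_integral_sqnorm2 (f : R -> \bar R) :
  measurable_fun [set: R] f -> (forall x, (0 <= f x)%E) ->
  (\int[(mu \x mu)%E]_w f (w.1 ^+ 2 + w.2 ^+ 2)%R
    = pi%:E * \int[mu]_(q in `[0%R, +oo[) f q)%E.
Proof.
move=> mf f0.
have pi0 : 0 < pi :> R := pi_gt0 R.
have piV0 : 0 <= pi^-1 :> R by rewrite invr_ge0 ltW.
pose p0 : {measure set (measurableTypeR R) -> \bar R} :=
  pushforward (mu \x mu)%E sqn.
pose m1 := mscale (NngNum piV0) (p0 msqn).
(* The image measure lives on nonnegative reals. Lebesgue measure on the negative ones is added so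
   that the sum can be identified with Lebesgue measure on the whole line. *)
pose m2 := mrestr mu (measurable_itv `]-oo, 0%R[ : measurable (`]-oo, 0%R[%classic : set (measurableTypeR R))).
pose m := measure_add m1 m2.
have mEq (A : set (measurableTypeR R)) :
    (m A = pi^-1%:E * (mu \x mu)%E (sqn @^-1` A) + mu (A `&` `]-oo, 0%R[))%E.
  by rewrite /m measure_addE.
have sqn0 w : 0 <= sqn w by rewrite addr_ge0// sqr_ge0.
have neg0 (A : set (measurableTypeR R)) : A `<=` [set x : R | x < 0] -> sqn @^-1` A = set0.
  by move=> A0; apply/seteqP; split => // w /= /A0 /=; rewrite ltNge sqn0.
have ocE (a b : R) : mu `]a, b] = m `]a, b]%classic.
  rewrite mEq /=; have [ba|ab] := leP b a.
    by rewrite set_itv_ge ?bnd_simp -?leNgt// preimage_set0 set0I !measure0 mule0 adde0.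
  have [a0|a0] := leP 0 a.
    rewrite measure_annulus// ?(ltW ab)//.
    rewrite [X in (_ + mu X)%E](_ : _ = set0); last first.
      apply/seteqP; split => // x /= [] /[!in_itv]/= /andP[ax _] x0; lra.
    rewrite measure0 adde0 -EFinM lebesgue_measure_itv/= lte_fin ab -EFinB.
    by rewrite mulKf// gt_eqF.
  have [b0|b0] := ltP b 0.
    rewrite neg0; last by move=> x /=; rewrite in_itv/=; lra.
    rewrite measure0 mule0 add0e; congr (mu _); apply/esym/setIidl.
    by move=> x /=; rewrite !in_itv/=; lra.
  rewrite (_ : sqn @^-1` `]a, b] = [set w : P | w.1 ^+ 2 + w.2 ^+ 2 <= b]); last first.
    apply/seteqP; split => w /=; rewrite in_itv/=; have := sqn0 w; rewrite /sqn; lra.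
  rewrite measure_disc// (_ : `]a, b] `&` _ = `]a, 0%R[%classic); last first.
    by apply/seteqP; split => x /=; rewrite !in_itv/=; lra.
  rewrite !lebesgue_measure_itv/= !lte_fin ab a0 -EFinM -!EFinB -EFinD.
  by rewrite mulKf ?gt_eqF//; congr (_%:E); ring.
have mE (A : set (measurableTypeR R)) : measurable A -> mu A = m A.
  by apply: lebesgue_measure_unique => _ [[a b]] _ <-; exact: ocE.
have mE0 (A : set (measurableTypeR R)) : measurable A -> A `<=` [set x : R | 0 <= x] -> mu A = m1 A.
  move=> mA A0; rewrite mE// mEq [X in (_ + mu X)%E](_ : _ = set0) ?measure0 ?adde0//.
  by apply/seteqP; split => // x /= [/A0 /=]; rewrite in_itv/= leNgt => /negP.
rewrite (eq_measure_integral m1) => [|A mA A0]; last first.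
  by apply: mE0 => // x /A0 /=; rewrite in_itv/= andbT.
rewrite ge0_integral_mscale//=; last by exact: measurable_funTS.
rewrite muleA -EFinM divff ?mul1e ?gt_eqF//.
rewrite (ge0_integral_pushforward (phi := sqn))//; last by exact: measurable_funTS.
rewrite (_ : sqn @^-1` `[0%R, +oo[ = setT)//.
by apply/seteqP; split => // w _ /=; rewrite in_itv/= andbT.
Qed.

End plane.

(** * Tonelli and rotations in space *)

Lemma product_measure1_sigma_finite d1 d2 (T1 : measurableType d1)
    (T2 : measurableType d2) (R : realType)
    (m1 : {sigma_finite_measure set T1 -> \bar R})
    (m2 : {sigma_finite_measure set T2 -> \bar R}) :
  sigma_finite setT (m1 \x m2)%E.
Proof.
have /sigma_finiteP[F [TF ndF Foo]] := sigma_finiteT m1.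
have /sigma_finiteP[G [TG ndG Goo]] := sigma_finiteT m2.
exists (fun n => F n `*` G n).
  rewrite -setXTT TF TG; apply/seteqP; split => [[x y]/=|[x y] [n _ []/= ? ?]].
    move=> [[n _ Fnx] [k _ Gky]]; exists (maxn n k) => //; split.
    - by move: x Fnx; exact/subsetPset/ndF/leq_maxl.
    - by move: y Gky; exact/subsetPset/ndG/leq_maxr.
  by split; exists n.
move=> k; have [? ?] := Foo k; have [? ?] := Goo k.
split; first exact: measurableX.
by rewrite product_measure1E// lte_mul_pinfty// ge0_fin_numE.
Qed.

(** A name for the product measure, which can then carry the sigma-finite structure required by
    Tonelli between the plane and the third axis. *)
Definition plane_lebesgue (R : realType) :
    set (measurableTypeR R * measurableTypeR R)%type -> \bar R :=
  ((@lebesgue_measure R) \x (@lebesgue_measure R))%E.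
HB.instance Definition _ (R : realType) := Measure.on (@plane_lebesgue R).
HB.instance Definition _ (R : realType) :=
  @Measure_isSigmaFinite.Build _ _ _ (@plane_lebesgue R)
    (product_measure1_sigma_finite _ _).

Section space.
Variable R : realType.
Local Notation mu := (@lebesgue_measure R).
Local Notation M := (measurableTypeR R).

Lemma ge0_integral_leb3 (f : M * M * M -> \bar R) :
  measurable_fun [set: M * M * M] f -> (forall x, (0 <= f x)%E) ->
  (\int[leb3 R]_y f y = \int[mu]_z \int[(mu \x mu)%E]_w f (w, z))%E.
Proof.
move=> mf f0.
pose m1 : {sigma_finite_measure set M -> \bar R} := mu.
pose m2 : {sigma_finite_measure set (M * M)%type -> \bar R} := @plane_lebesgue R.
transitivity (\int[(m2 \x m1)%E]_y f y)%E; first by [].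
exact: (fubini_tonelli2 f mf f0).
Qed.

Lemma measurable_sqnorm3 : measurable_fun [set: M * M * M]
  (fun y : M * M * M => y.1.1 ^+ 2 + y.1.2 ^+ 2 + y.2 ^+ 2 : M).
Proof.
apply: measurable_funD; last by apply: measurable_funX; exact: measurable_snd.
apply: measurable_funD; apply: measurable_funX.
- apply: (measurableT_comp measurable_fst); exact: measurable_fst.
- apply: (measurableT_comp measurable_snd); exact: measurable_fst.
Qed.

(* The pair (|y|^2, y_3) has, under Lebesgue measure, the density
   pi 1_{z^2 <= q} dq dz: the slice of the ball at height z is a disc of radius
   sqrt (q - z^2), whose area is affine in q. *)
Lemma ge0_integral_sqnorm_height (f : M * M -> \bar R) :
  measurable_fun [set: M * M] f -> (forall x, (0 <= f x)%E) ->
  (\int[leb3 R]_y f (y.1.1 ^+ 2 + y.1.2 ^+ 2 + y.2 ^+ 2, y.2)%R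
    = pi%:E * \int[mu]_q \int[mu]_z (if (z ^+ 2 <= q)%R then f (q, z) else 0))%E.
Proof.
move=> mf f0.
have mz2 : measurable_fun [set: M] (fun z : M => z ^+ 2 : M) by exact: measurable_funX.
have mle : measurable_fun [set: M * M] (fun x : M * M => (x.2 ^+ 2 <= x.1)%R).
  by apply: measurable_fun_ler => //; apply: measurable_funX; exact: measurable_snd.
have mfi : measurable_fun [set: M * M]
    (fun x : M * M => if (x.2 ^+ 2 <= x.1)%R then f (x.1, x.2) else 0%E).
  apply: measurable_fun_ifT => //.
  by under eq_fun do rewrite -surjective_pairing.
rewrite ge0_integral_leb3; [|exact: (measurableT_comp mf
  (measurable_fun_pair measurable_sqnorm3 measurable_snd))|by move=> y; exact: f0].
transitivity (\int[mu]_z (pi%:E * \int[mu]_q (if (z ^+ 2 <= q)%R then f (q, z) else 0)))%E.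
  apply: eq_integral => z _.
  rewrite (ge0_integral_sqnorm2 (f := fun q => f (q + z ^+ 2, z)%R))//; last first.
    apply: (measurableT_comp mf); apply: measurable_fun_pair => //=.
    by apply: measurable_funD.
  congr (_ * _)%E.
  rewrite -[RHS](@ge0_integral_affine R 1 (z ^+ 2))//; last 2 first.
  - exact: (measurableT_comp mfi (measurable_fun_pair _ _)).
  - by move=> q; case: ifP.
  rewrite mul1e [LHS]integral_mkcond; apply: eq_integral => q _.
  by rewrite patchE mem_setE in_itv/= andbT mul1r lerDr; case: leP.
have mfi0 x : (0 <= (fun x : M * M => if (x.2 ^+ 2 <= x.1)%R then f (x.1, x.2) else 0) x)%E.
  by rewrite /=; case: ifP.
have mG := measurable_fun_fubini_tonelli_G (m1 := mu) _ mfi mfi0.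
have G0 z : (0 <= \int[mu]_q (if (z ^+ 2 <= q)%R then f (q, z) else 0))%E.
  by apply: integral_ge0 => q _; case: ifP.
rewrite (ge0_integralZl mu measurableT mG) => [|z _|]; [|exact: G0|by rewrite lee_fin pi_ge0].
congr (_ * _)%E.
rewrite [RHS](fubini_tonelli (fun x : M * M => if (x.2 ^+ 2 <= x.1)%R then f (x.1, x.2) else 0%E))//.
Qed.

(** For a fixed second coordinate a shear is a translation. *)
Lemma ge0_integral_shearl (a : R) (f : M * M -> \bar R) :
  measurable_fun [set: M * M] f -> (forall x, (0 <= f x)%E) ->
  (\int[(mu \x mu)%E]_w f (w.1 + a * w.2, w.2)%R = \int[(mu \x mu)%E]_w f w)%E.
Proof.
move=> mf f0.
have ms : measurable_fun [set: M * M] (fun w : M * M => (w.1 + a * w.2, w.2)%R : M * M).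
  apply: measurable_fun_pair => //=; apply: measurable_funD => //=.
  exact: measurable_funM.
rewrite (fubini_tonelli2 (fun w : M * M => f (w.1 + a * w.2, w.2)%R))//; last first.
  exact: (measurableT_comp mf ms).
rewrite [RHS](fubini_tonelli2 _ mf f0); apply: eq_integral => y _; rewrite /fubini_G /=.
rewrite -[RHS](@ge0_integral_affine R 1 (a * y))//.
  by rewrite mul1e; apply: eq_integral => x _; rewrite mul1r.
exact: (measurableT_comp mf (measurable_fun_pair _ _)).
Qed.

Lemma ge0_integral_shearr (a : R) (f : M * M -> \bar R) :
  measurable_fun [set: M * M] f -> (forall x, (0 <= f x)%E) ->
  (\int[(mu \x mu)%E]_w f (w.1, w.2 + a * w.1)%R = \int[(mu \x mu)%E]_w f w)%E.
Proof.
move=> mf f0.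
have ms : measurable_fun [set: M * M] (fun w : M * M => (w.1, w.2 + a * w.1)%R : M * M).
  apply: measurable_fun_pair => //=; apply: measurable_funD => //=.
  exact: measurable_funM.
rewrite (fubini_tonelli1 (fun w : M * M => f (w.1, w.2 + a * w.1)%R))//; last first.
  exact: (measurableT_comp mf ms).
rewrite [RHS](fubini_tonelli1 _ mf f0); apply: eq_integral => y _; rewrite /fubini_F /=.
rewrite -[RHS](@ge0_integral_affine R 1 (a * y))//.
  by rewrite mul1e; apply: eq_integral => x _; rewrite mul1r.
exact: (measurableT_comp mf (measurable_fun_pair _ _)).
Qed.

(* A rotation other than by pi is a product of three shears. *)
Lemma ge0_integral_rotation (c s : R) (f : M * M -> \bar R) :
  c ^+ 2 + s ^+ 2 = 1 -> c != -1 ->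
  measurable_fun [set: M * M] f -> (forall x, (0 <= f x)%E) ->
  (\int[(mu \x mu)%E]_w f (c * w.1 - s * w.2, s * w.1 + c * w.2)%R = \int[(mu \x mu)%E]_w f w)%E.
Proof.
move=> cs c1 mf f0.
have c10 : 1 + c != 0 by rewrite addrC -(opprK 1) subr_eq0.
have s2 : s ^+ 2 = 1 - c ^+ 2 by lra.
(* If c and s are the cosine and sine of an angle, t is minus the tangent of its half; the outer
   shears have slope t, the middle one slope s. The half-angle tangent is infinite exactly at c =
   -1. *)
pose t := - (s / (1 + c)).
have mS a : measurable_fun [set: M * M] (fun w : M * M => (w.1 + a * w.2, w.2)%R : M * M).
  apply: measurable_fun_pair => //=; apply: measurable_funD => //=.
  exact: measurable_funM.
have mS' a : measurable_fun [set: M * M] (fun w : M * M => (w.1, w.2 + a * w.1)%R : M * M).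
  apply: measurable_fun_pair => //=; apply: measurable_funD => //=.
  exact: measurable_funM.
rewrite -(@ge0_integral_shearl t f)//.
rewrite -[RHS](@ge0_integral_shearr s)//; last by exact: (measurableT_comp mf).
rewrite -[RHS](@ge0_integral_shearl t)//; last first.
  by apply: (measurableT_comp (measurableT_comp mf (mS t)) (mS' s)).
apply: eq_integral => -[x y] _ /=; congr (f (_, _)); rewrite /t.
- have -> : x + - (s / (1 + c)) * y + - (s / (1 + c)) * (y + s * (x + - (s / (1 + c)) * y))
    = x - s * y - (s ^+ 2 / (1 + c) - (1 - c)) * (x - s / (1 + c) * y) - (1 - c) * x
      + (1 - c - (1 - c)) * y by field.
  have -> : s ^+ 2 / (1 + c) = 1 - c by rewrite s2; field.
  by field.
- have -> : y + s * (x + - (s / (1 + c)) * y) = s * x + y - s ^+ 2 / (1 + c) * y by field.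
  have -> : s ^+ 2 / (1 + c) = 1 - c by rewrite s2; field.
  by ring.
Qed.

(** Rotations are first obtained in the plane of the first two coordinates. Conjugating by this
    exchange gives those in the plane of the first and third, and the two families suffice to move
    any point to an axis. *)
Lemma ge0_integral_leb3_swap (f : M * M * M -> \bar R) :
  measurable_fun [set: M * M * M] f -> (forall x, (0 <= f x)%E) ->
  (\int[leb3 R]_y f ((y.1.1, y.2), y.1.2) = \int[leb3 R]_y f y)%E.
Proof.
move=> mf f0.
have msw : measurable_fun [set: M * M * M] (fun y : M * M * M => ((y.1.1, y.2), y.1.2)).
  have m1 := measurable_fst : measurable_fun [set: M * M * M] fst.
  apply: measurable_fun_pair; last exact: (measurableT_comp measurable_snd m1).
  by apply: measurable_fun_pair; [exact: (measurableT_comp measurable_fst m1)|exact: measurable_snd].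
have mf' : measurable_fun [set: M * M * M] (fun y : M * M * M => f ((y.1.1, y.2), y.1.2)).
  exact: (measurableT_comp mf msw).
rewrite (ge0_integral_leb3 mf'); last by move=> y; exact: f0.
rewrite (ge0_integral_leb3 mf); last by move=> y; exact: f0.
pose g (u : M * M) : \bar R := (\int[mu]_x f ((x, u.1), u.2))%E.
have g0 u : (0 <= g u)%E by apply: integral_ge0 => x _.
have mg : measurable_fun [set: M * M] g.
  pose h (v : M * (M * M)) := f ((v.1, v.2.1), v.2.2).
  have mh : measurable_fun [set: M * (M * M)] h.
    have m2 := measurable_snd : measurable_fun [set: M * (M * M)] snd.
    apply: (measurableT_comp mf); apply: measurable_fun_pair; last exact: (measurableT_comp measurable_snd m2).
    by apply: measurable_fun_pair; [exact: measurable_fst|exact: (measurableT_comp measurable_fst m2)].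
  exact: (measurable_fun_fubini_tonelli_G (m1 := mu) h mh (fun=> f0 _)).
transitivity (\int[mu]_z \int[mu]_y g (z, y))%E.
  apply: eq_integral => z _; rewrite (fubini_tonelli2 (fun w : M * M => f ((w.1, z), w.2)))//.
  exact: measurable_fun_pair1 mf'.
rewrite (fubini_tonelli g mg g0).
apply: eq_integral => z _; rewrite (fubini_tonelli2 (fun w : M * M => f (w, z)))//.
exact: measurable_fun_pair1 mf.
Qed.

Lemma measurable_rotation (c s : R) : measurable_fun [set: M * M]
  (fun w : M * M => (c * w.1 - s * w.2, s * w.1 + c * w.2)%R : M * M).
Proof.
apply: measurable_fun_pair.
- by apply: measurable_funB; exact: measurable_funM.
- by apply: measurable_funD; exact: measurable_funM.
Qed.

Lemma ge0_integral_rotation12 (c s : R) (f : M * M * M -> \bar R) :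
  c ^+ 2 + s ^+ 2 = 1 -> c != -1 ->
  measurable_fun [set: M * M * M] f -> (forall x, (0 <= f x)%E) ->
  (\int[leb3 R]_y f ((c * y.1.1 - s * y.1.2, s * y.1.1 + c * y.1.2), y.2)%R
    = \int[leb3 R]_y f y)%E.
Proof.
move=> cs c1 mf f0.
have mf' : measurable_fun [set: M * M * M] (fun y : M * M * M => f ((c * y.1.1 - s * y.1.2, s * y.1.1 + c * y.1.2), y.2)%R).
  apply: (measurableT_comp mf); apply: measurable_fun_pair; last exact: measurable_snd.
  exact: (measurableT_comp (measurable_rotation c s) measurable_fst).
rewrite (ge0_integral_leb3 mf'); last by move=> y; exact: f0.
rewrite (ge0_integral_leb3 mf); last by move=> y; exact: f0.
apply: eq_integral => z _.
by rewrite (ge0_integral_rotation (f := fun w => f (w, z)) cs c1)//; exact: measurable_fun_pair1 mf.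
Qed.

Lemma ge0_integral_rotation13 (c s : R) (f : M * M * M -> \bar R) :
  c ^+ 2 + s ^+ 2 = 1 -> c != -1 ->
  measurable_fun [set: M * M * M] f -> (forall x, (0 <= f x)%E) ->
  (\int[leb3 R]_y f ((c * y.1.1 - s * y.2, y.1.2), s * y.1.1 + c * y.2)%R
    = \int[leb3 R]_y f y)%E.
Proof.
move=> cs c1 mf f0.
have m1 := measurable_fst : measurable_fun [set: M * M * M] fst.
have m2 := measurable_snd : measurable_fun [set: M * M * M] snd.
have msw : measurable_fun [set: M * M * M] (fun y : M * M * M => ((y.1.1, y.2), y.1.2)).
  apply: measurable_fun_pair; last exact: (measurableT_comp measurable_snd m1).
  by apply: measurable_fun_pair; [exact: (measurableT_comp measurable_fst m1)|exact: measurable_snd].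
pose g (y : M * M * M) := f ((y.1.1, y.2), y.1.2).
have mg : measurable_fun [set: M * M * M] g by exact: (measurableT_comp mf msw).
have mr : measurable_fun [set: M * M * M] (fun y : M * M * M => ((c * y.1.1 - s * y.1.2, s * y.1.1 + c * y.1.2), y.2)%R).
  apply: measurable_fun_pair; last exact: measurable_snd.
  exact: (measurableT_comp (measurable_rotation c s) measurable_fst).
rewrite -[RHS](ge0_integral_leb3_swap mf f0).
rewrite -[RHS](ge0_integral_rotation12 (f := g) cs c1 mg); last by move=> y; exact: f0.
rewrite -[RHS](ge0_integral_leb3_swap (f := fun y => g ((c * y.1.1 - s * y.1.2, s * y.1.1 + c * y.1.2), y.2)%R)).
- by [].
- exact: (measurableT_comp mg mr).
- by move=> y; exact: f0.
Qed.

End space.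

(** On nonnegative reals inversion is the real power -1, also at 0, where both take the value 0. *)
Lemma measurable_fun_invr_ge0 d (T : measurableType d) (R : realType) (D : set T)
    (f : T -> R) :
  (forall x, 0 <= f x) -> measurable_fun D f -> measurable_fun D (fun x => (f x)^-1).
Proof.
move=> f0 mf; under eq_fun do rewrite -powR_inv1//.
exact: (measurableT_comp (measurable_powR (-1)) mf).
Qed.

(** * Newton's shell theorem *)

Section shell.
Variable R : realType.
Local Notation mu := (@lebesgue_measure R).
Local Notation M := (measurableTypeR R).

Lemma integral_sqr_le (q : R) (h : R -> \bar R) : 0 <= q ->
  (\int[mu]_z (if (z ^+ 2 <= q)%R then h z else 0)
    = \int[mu]_(z in `[(- Num.sqrt q)%R, Num.sqrt q]) h z)%E.
Proof.
move=> q0; rewrite [RHS]integral_mkcond; apply: eq_integral => z _.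
by rewrite patchE mem_setE in_itv/= -ler_norml -sqrtr_sqr ler_sqrt.
Qed.

Lemma integral_sqr_le_neg (q : R) (h : R -> \bar R) : q < 0 ->
  (\int[mu]_z (if (z ^+ 2 <= q)%R then h z else 0) = 0)%E.
Proof.
move=> q0; apply: integral0_eq => z _; case: ifPn => // zq.
by have := le_lt_trans zq q0; rewrite ltNge sqr_ge0.
Qed.

Lemma ge0_integral_radial (f : R -> R) :
  measurable_fun [set: R] f -> (forall q, 0 <= f q) ->
  (\int[leb3 R]_y (f (y.1.1 ^+ 2 + y.1.2 ^+ 2 + y.2 ^+ 2))%:E
    = (2 * pi)%:E * \int[mu]_(q in `[0%R, +oo[) (Num.sqrt q * f q)%:E)%E.
Proof.
move=> mf f0.
rewrite (@ge0_integral_sqnorm_height R (fun x => (f x.1)%:E)); first last.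
- by move=> x; rewrite lee_fin.
- apply/measurable_EFinP; exact: (measurableT_comp mf measurable_fst).
rewrite mulrC EFinM -muleA; congr (_ * _)%E.
rewrite -ge0_integralZl_EFin//; first last.
- apply/measurable_EFinP; apply: measurable_funTS; apply: measurable_funM => //.
  exact: measurable_fun_sqrt.
- by move=> q _; rewrite lee_fin mulr_ge0// sqrtr_ge0.
rewrite [RHS]integral_mkcond; apply: eq_integral => q _.
rewrite patchE mem_setE in_itv/= andbT; case: leP => q0; last exact: integral_sqr_le_neg.
rewrite integral_sqr_le// integral_cst//= lebesgue_measure_itv/= lte_fin.
have := sqrtr_ge0 q; rewrite le_eqVlt => /predU1P[<-|s0].
  by rewrite oppr0 ltxx mule0 mul0r mule0.
by rewrite gtrN// -EFinB -!EFinM; congr (_%:E); ring.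
Qed.

(** The squared distance from a point on the axis at height r to a point at height z of the sphere
    of radius s is affine in z, so the inverse distance has an elementary primitive. Its increment
    is (|s + r| - |s - r|) / r, whence the minimum. The radicand is at least (s - |r|)^2, which is
    why s = |r| is excluded. *)
Lemma integral_inverse_distance (s r : R) : 0 < s -> r != 0 -> s != `|r| ->
  (\int[mu]_(z in `[(- s)%R, s]) ((Num.sqrt (s ^+ 2 + r ^+ 2 - 2 * r * z))^-1)%:E
    = (2 * (Num.min s `|r| / `|r|))%:E)%E.
Proof.
move=> s0 r0 sr.
have pos z : - s <= z <= s -> 0 < s ^+ 2 + r ^+ 2 - 2 * r * z.
  rewrite -ler_norml => zs.
  have h : r * z <= `|r| * s.
    by rewrite (le_trans (ler_norm _))// normrM ler_wpM2l.
  have : 0 < (s - `|r|) ^+ 2 by rewrite exprn_even_gt0//= subr_eq0.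
  have : `|r| ^+ 2 = r ^+ 2 by rewrite real_normK ?num_real.
  nra.
pose F (z : R) := - r^-1 * Num.sqrt (s ^+ 2 + r ^+ 2 - 2 * r * z).
have cin : continuous (fun z : R => s ^+ 2 + r ^+ 2 - 2 * r * z).
  by move=> z; apply: cvgB; [exact: cvg_cst|apply: cvgM; [exact: cvg_cst|exact: cvg_id]].
have csq : continuous (fun z : R => Num.sqrt (s ^+ 2 + r ^+ 2 - 2 * r * z)).
  by move=> z; apply: (@continuous_comp R R R); [exact: cin|exact: sqrt_continuous].
have dF (z : R) : - s <= z <= s -> is_derive z 1 F ((Num.sqrt (s ^+ 2 + r ^+ 2 - 2 * r * z))^-1).
  move=> zs; have p := pos _ zs.
  have h := is_derive1_sqrt p.
  have g : is_derive z 1 (fun z : R => s ^+ 2 + r ^+ 2 - 2 * r * z) (- (2 * r)).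
    by apply: is_derive_eq; rewrite /GRing.scale /=; ring.
  have k : is_derive z 1 (fun z : R => Num.sqrt (s ^+ 2 + r ^+ 2 - 2 * r * z))
      ((2 * Num.sqrt (s ^+ 2 + r ^+ 2 - 2 * r * z))^-1 * - (2 * r)).
    exact: (is_derive1_comp (g := fun z : R => s ^+ 2 + r ^+ 2 - 2 * r * z) h g).
  have := is_deriveZ (- r^-1) k; rewrite /F => kk.
  apply: (is_derive_eq kk); rewrite /GRing.scale /=.
  by field; rewrite r0 gt_eqF// sqrtr_gt0.
rewrite (@continuous_FTC2 R _ F) //; first last.
- by move=> z /[!in_itv]/= /andP[z1 z2]; rewrite derive1E; apply: derive_val; apply: dF; rewrite !ltW.
- have cF : continuous F by move=> z; apply: cvgM; [exact: cvg_cst|exact: csq].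
  split.
  + by move=> z /[!in_itv]/= /andP[z1 z2]; apply: ex_derive; apply: dF; rewrite !ltW.
  + by apply: cvg_at_right_filter; exact: cF.
  + by apply: cvg_at_left_filter; exact: cF.
- apply: continuous_in_subspaceT => z; rewrite inE/= in_itv/= => zs.
  by apply: cvgV; [rewrite gt_eqF// sqrtr_gt0 pos|exact: csq].
- by rewrite gtrN.
rewrite -EFinB; congr (_%:E); rewrite /F.
have -> : s ^+ 2 + r ^+ 2 - 2 * r * s = (s - r) ^+ 2 by ring.
have -> : s ^+ 2 + r ^+ 2 - 2 * r * - s = (s + r) ^+ 2 by ring.
rewrite !sqrtr_sqr.
have [rp|rn] := ltP 0 r.
- rewrite (gtr0_norm rp) (gtr0_norm (addr_gt0 s0 rp)).
  have [h|h] := leP s r.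
    by rewrite ler0_norm ?subr_le0//; field.
  by rewrite gtr0_norm ?subr_gt0//; field.
- have rn' : r < 0 by rewrite lt_neqAle r0.
  rewrite (ltr0_norm rn') [ `|s - r| ]gtr0_norm ?subr_gt0 ?(lt_trans rn')//.
  have [h|h] := leP s (- r).
    by rewrite ler0_norm; [field|lra].
  by rewrite gtr0_norm; [field|lra].
Qed.

Lemma ge0_integral_shell_axis (f : R -> R) (r : R) : r != 0 ->
  measurable_fun [set: R] f -> (forall q, 0 <= f q) ->
  (\int[leb3 R]_y (f (y.1.1 ^+ 2 + y.1.2 ^+ 2 + y.2 ^+ 2)
      / enorm (((0, 0), r) - y : R * R * R))%:E
    = (2 * pi)%:E * \int[mu]_(q in `[0%R, +oo[)
        (f q * (Num.min (Num.sqrt q) `|r| / `|r|))%:E)%E.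
Proof.
move=> r0 mf f0.
pose g (x : M * M) := (f x.1 / Num.sqrt (x.1 + r ^+ 2 - 2 * r * x.2))%:E.
have g0 x : (0 <= g x)%E by rewrite lee_fin divr_ge0// sqrtr_ge0.
have mg : measurable_fun [set: M * M] g.
  apply/measurable_EFinP; apply: measurable_funM.
    exact: (measurableT_comp mf measurable_fst).
  apply: measurable_fun_invr_ge0 => [x|]; first exact: sqrtr_ge0.
  apply: measurable_fun_sqrt.
  apply: measurable_funB; first exact: measurable_funD.
  exact: measurable_funM.
transitivity (\int[leb3 R]_y g (y.1.1 ^+ 2 + y.1.2 ^+ 2 + y.2 ^+ 2, y.2)%R)%E.
  apply: eq_integral => y _; rewrite /g /enorm /=; congr ((_ / Num.sqrt _)%:E).
  by ring.
rewrite (ge0_integral_sqnorm_height mg g0).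
rewrite mulrC EFinM -muleA; congr (_ * _)%E.
rewrite -ge0_integralZl_EFin//; first last.
- apply/measurable_EFinP; apply: measurable_funTS; apply: measurable_funM => //.
  apply: measurable_funM => //; apply: measurable_minr => //; exact: measurable_fun_sqrt.
- by move=> q _; rewrite lee_fin mulr_ge0// divr_ge0// le_min sqrtr_ge0 normr_ge0.
rewrite [RHS]integral_mkcond.
apply: ge0_ae_eq_integral => //.
- pose G (x : M * M) := (if (x.2 ^+ 2 <= x.1)%R then g x else 0)%E.
  have mG : measurable_fun [set: M * M] G.
    apply: measurable_fun_ifT => //; apply: measurable_fun_ler => //.
    by apply: measurable_funX; exact: measurable_snd.
  by apply: (measurable_fun_fubini_tonelli_F (m2 := mu) G mG) => x; rewrite /G; case: ifP.
- apply: (measurable_restrictT _ _).1 => //; apply: emeasurable_funM => //.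
  apply/measurable_EFinP.
  apply: measurable_funTS; apply: measurable_funM => //.
  apply: measurable_funM => //; apply: measurable_minr => //; exact: measurable_fun_sqrt.
- by move=> q _; apply: integral_ge0 => z _; case: ifP.
- by move=> q _; rewrite patchE; case: ifP => // _; rewrite mule_ge0// lee_fin mulr_ge0// divr_ge0// le_min sqrtr_ge0 normr_ge0.
(* The sphere through the pole, where the radicand reaches 0, and the degenerate sphere q = 0 are
   discarded as a null set. *)
exists [set r ^+ 2; 0]; split => //.
- by apply: measurableU; exact: measurable_set1.
- by apply: countable_lebesgue_measure0; apply: finite_set_countable.
move=> q /= h; apply: contrapT => qn; apply: h => _.
have {qn} [qr q0] : q != r ^+ 2 /\ q != 0.
  by split; apply/eqP => qq; apply: qn; [left|right].
rewrite patchE mem_setE in_itv/= andbT; case: leP => q0'; last exact: integral_sqr_le_neg.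
have {q0 q0'}q0 : 0 < q by rewrite lt_neqAle eq_sym q0.
rewrite integral_sqr_le ?ltW// /g /=.
under eq_integral do rewrite EFinM.
rewrite ge0_integralZl_EFin//; first last.
- apply/measurable_EFinP; apply: measurable_funTS.
  apply: measurable_fun_invr_ge0 => [x|]; first exact: sqrtr_ge0.
  by apply: measurable_fun_sqrt; apply: measurable_funB => //; exact: measurable_funM.
have := @integral_inverse_distance (Num.sqrt q) r; rewrite sqr_sqrtr ?ltW// => ->.
- by rewrite -!EFinM; congr (_%:E); ring.
- by rewrite sqrtr_gt0.
- by [].
- apply: contra qr => /eqP h; by rewrite -(real_normK (num_real r)) -h sqr_sqrtr ?ltW.
Qed.

Definition newton_integral (f : R -> R) (x : R * R * R) : \bar R :=
  (\int[leb3 R]_y (f (y.1.1 ^+ 2 + y.1.2 ^+ 2 + y.2 ^+ 2) / enorm (x - y))%:E)%E.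

Lemma measurable_enorm : measurable_fun [set: M * M * M] (@enorm R : M * M * M -> M).
Proof. exact: (measurable_fun_sqrt (@measurable_sqnorm3 R)). Qed.

Lemma measurable_translate (x : M * M * M) :
  measurable_fun [set: M * M * M] (fun y : M * M * M => (x - y : R * R * R) : M * M * M).
Proof.
have m1 := measurable_fst : measurable_fun [set: M * M * M] fst.
apply: (@measurable_fun_pair _ _ _ _ _ _ (fun y : M * M * M => (x.1.1 - y.1.1, x.1.2 - y.1.2)) (fun y : M * M * M => x.2 - y.2)).
  apply: measurable_fun_pair.
  - by apply: measurable_funB => //; exact: (measurableT_comp measurable_fst m1).
  - by apply: measurable_funB => //; exact: (measurableT_comp measurable_snd m1).
by apply: measurable_funB.
Qed.

Lemma measurable_newton_integrand (f : R -> R) (x : R * R * R) :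
  measurable_fun [set: R] f -> measurable_fun [set: M * M * M]
   (fun y : M * M * M => (f (y.1.1 ^+ 2 + y.1.2 ^+ 2 + y.2 ^+ 2) / enorm (x - y : R * R * R)) : M).
Proof.
move=> mf; apply: measurable_funM; first exact: (measurableT_comp mf (@measurable_sqnorm3 R)).
apply: measurable_fun_invr_ge0 => [y|]; first exact: sqrtr_ge0.
exact: (measurableT_comp measurable_enorm (measurable_translate x)).
Qed.

Section newton_rotation.
Variables (f : R -> R) (mf : measurable_fun [set: R] f) (f0 : forall q, 0 <= f q).

Let nonneg (x y : R * R * R) :
  (0 <= (f (y.1.1 ^+ 2 + y.1.2 ^+ 2 + y.2 ^+ 2) / enorm (x - y))%:E)%E.
Proof. by rewrite lee_fin divr_ge0// sqrtr_ge0. Qed.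

Lemma newton_integral_rotation12 (c s : R) (x : R * R * R) :
  c ^+ 2 + s ^+ 2 = 1 -> c != -1 ->
  newton_integral f x
    = newton_integral f (c * x.1.1 - s * x.1.2, s * x.1.1 + c * x.1.2, x.2).
Proof.
move=> cs c1; pose x' : R * R * R := (c * x.1.1 - s * x.1.2, s * x.1.1 + c * x.1.2, x.2).
rewrite /newton_integral -/x' -[RHS](@ge0_integral_rotation12 R c s (fun y : M * M * M =>
    (f (y.1.1 ^+ 2 + y.1.2 ^+ 2 + y.2 ^+ 2) / enorm (x' - y : R * R * R))%:E) cs c1); first last.
- by move=> y; exact: nonneg.
- by apply/measurable_EFinP; exact: measurable_newton_integrand.
have s2 : s ^+ 2 = 1 - c ^+ 2 by lra.
apply: eq_integral => y _; rewrite /enorm /x' /=; congr (EFin (f _ / Num.sqrt _)).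
- by apply/eqP; rewrite -subr_eq0; apply/eqP; ring: s2.
- by apply/eqP; rewrite -subr_eq0; apply/eqP; ring: s2.
Qed.

Lemma newton_integral_rotation13 (c s : R) (x : R * R * R) :
  c ^+ 2 + s ^+ 2 = 1 -> c != -1 ->
  newton_integral f x
    = newton_integral f (c * x.1.1 - s * x.2, x.1.2, s * x.1.1 + c * x.2).
Proof.
move=> cs c1; pose x' : R * R * R := (c * x.1.1 - s * x.2, x.1.2, s * x.1.1 + c * x.2).
rewrite /newton_integral -/x' -[RHS](@ge0_integral_rotation13 R c s (fun y : M * M * M =>
    (f (y.1.1 ^+ 2 + y.1.2 ^+ 2 + y.2 ^+ 2) / enorm (x' - y : R * R * R))%:E) cs c1); first last.
- by move=> y; exact: nonneg.
- by apply/measurable_EFinP; exact: measurable_newton_integrand.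
have s2 : s ^+ 2 = 1 - c ^+ 2 by lra.
apply: eq_integral => y _; rewrite /enorm /x' /=; congr (EFin (f _ / Num.sqrt _)).
- by apply/eqP; rewrite -subr_eq0; apply/eqP; ring: s2.
- by apply/eqP; rewrite -subr_eq0; apply/eqP; ring: s2.
Qed.

(** The rotation sends (b, a) to (d, 0), where d is its length. Its cosine b / d is -1 only if a =
    0, so the half-turn that the shears cannot produce never occurs. *)
Lemma rotate_to_axis (a b : R) : a != 0 ->
  exists c s, [/\ c ^+ 2 + s ^+ 2 = 1, c != -1, s * b + c * a = 0
    & (c * b - s * a) ^+ 2 = a ^+ 2 + b ^+ 2].
Proof.
move=> a0; pose d := Num.sqrt (a ^+ 2 + b ^+ 2).
have p : 0 < a ^+ 2 + b ^+ 2 by rewrite ltr_wpDr ?sqr_ge0// exprn_even_gt0.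
have d0 : 0 < d by rewrite sqrtr_gt0.
have d2 : d ^+ 2 = a ^+ 2 + b ^+ 2 by rewrite sqr_sqrtr// ltW.
have dn : d != 0 by rewrite gt_eqF.
exists (b / d), (- a / d); split.
- have -> : (b / d) ^+ 2 + (- a / d) ^+ 2 = (a ^+ 2 + b ^+ 2) / d ^+ 2 by field.
  by rewrite -d2 divff// expf_neq0.
- apply: contra_neq a0 => h; have bd : b = - d by rewrite -[b](divfK dn) h mulN1r.
  by apply/eqP; rewrite -sqrf_eq0; apply/eqP; move: d2; rewrite bd sqrrN; lra.
- by field.
- have -> : b / d * b - - a / d * a = (a ^+ 2 + b ^+ 2) / d by field.
  by rewrite -d2 expr2 mulfK// -expr2.
Qed.

(** Two rotations, each skipped when the coordinate that it should remove is already 0. The sign of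
    r stays undetermined, which is harmless because the shell formula involves only |r|. *)
Lemma newton_integral_axis (x : R * R * R) :
  exists r, r ^+ 2 = x.1.1 ^+ 2 + x.1.2 ^+ 2 + x.2 ^+ 2
    /\ newton_integral f x = newton_integral f (0, 0, r).
Proof.
case: x => [[x1 x2] x3] /=.
have [a [a2 ->]] : exists a, a ^+ 2 = x1 ^+ 2 + x2 ^+ 2 /\
    newton_integral f (x1, x2, x3) = newton_integral f (a, 0, x3).
  have [->|x20] := eqVneq x2 0; first by exists x1; rewrite expr0n/= addr0.
  have [c [s [cs c1 h1 h2]]] := rotate_to_axis x1 x20.
  exists (c * x1 - s * x2); split; first by rewrite h2 addrC.
  by rewrite (newton_integral_rotation12 _ cs c1)/= h1.
have [a0|a0] := eqVneq a 0.
  by exists x3; rewrite -a2 a0 expr0n/= add0r.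
(* Here the first coordinate of the rotated pair must vanish instead of the second, which amounts to
   changing the sign of [x3]. *)
have [c [s [cs c1 h1 h2]]] := rotate_to_axis (- x3) a0.
have h3 : c * a - s * x3 = 0 by lra.
exists (s * a + c * x3); split; first by rewrite -a2; move: h2; lra.
have := newton_integral_rotation13 (a, 0, x3) cs c1.
by rewrite [X in _ = newton_integral f X](_ : _ = (0, 0, s * a + c * x3))//= h3.
Qed.

Lemma newton_integralE (x : R * R * R) :
  newton_integral f x = ((2 * pi)%:E * \int[mu]_(q in `[0%R, +oo[)
    (f q * (if enorm x == 0 then 1 else Num.min (Num.sqrt q) (enorm x) / enorm x))%:E)%E.
Proof.
have [r [r2 ->]] := newton_integral_axis x.
have -> : enorm x = `|r| by rewrite /enorm -r2 sqrtr_sqr.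
rewrite normr_eq0; have [->|r0] := eqVneq r 0; last exact: ge0_integral_shell_axis.
(* At the centre the distance to y is |y|, so the integrand is itself radial. The weight 1 in the
   formula is the limit of min (sqrt q, r) / r as r tends to 0. *)
pose h (q : R) := f q / Num.sqrt q.
have -> : newton_integral f (0, 0, 0) = (\int[leb3 R]_y (h (y.1.1 ^+ 2 + y.1.2 ^+ 2 + y.2 ^+ 2))%:E)%E.
  apply: eq_integral => y _; rewrite /h /enorm /=; congr (EFin (_ / Num.sqrt _)).
  ring.
have mh : measurable_fun [set: R] h.
  apply: measurable_funM => //; apply: measurable_fun_invr_ge0 => [q|]; first exact: sqrtr_ge0.
  exact: measurable_fun_sqrt.
rewrite ge0_integral_radial//; last by move=> q; rewrite divr_ge0// sqrtr_ge0.
congr (_ * _)%E.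
(* The point q = 0 is removed, since there sqrt q / sqrt q is 0 and not 1. *)
rewrite -!integral_itv_obnd_cbnd; first last.
- apply/measurable_EFinP; apply: measurable_funTS; apply: measurable_funM => //; exact: measurable_fun_sqrt.
- apply/measurable_EFinP; apply: measurable_funTS; exact: measurable_funM.
apply: eq_integral => q; rewrite inE/= in_itv/= andbT => q0; rewrite /h mulr1.
by congr EFin; field; rewrite gt_eqF// sqrtr_gt0.
Qed.

End newton_rotation.

End shell.

Lemma is_derive_powR (R : realType) (r x : R) : 0 < x ->
  is_derive x 1 (@powR R ^~ r) (r * x `^ (r - 1)).
Proof.
move=> x0; have xI : x \in `]0, +oo[ by rewrite in_itv/= x0.
apply: DeriveDef; first exact: derivable_powR.
by rewrite -derive1E powR_derive1.
Qed.

Lemma continuous_powR (R : realType) (r x : R) : 0 < x ->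
  {for x, continuous (@powR R ^~ r)}.
Proof.
move=> x0; apply/differentiable_continuous/derivable1_diffP.
by have := is_derive_powR r x0 => ?; exact: ex_derive.
Qed.

(** * The velocity integral of a polytrope *)

Section velocity.
Variable R : realType.
Local Notation mu := (@lebesgue_measure R).
Local Notation M := (measurableTypeR R).

Lemma pos_pow_ge0 (a k : R) : 0 <= pos_pow a k.
Proof. by rewrite /pos_pow; case: ifP => // _; exact: powR_ge0. Qed.

Lemma measurable_pos_pow (k : R) : measurable_fun [set: R] (fun a : R => pos_pow a k).
Proof.
rewrite /pos_pow; apply: measurable_fun_ifT => //.
exact: measurable_fun_ltr.
Qed.

Lemma pos_powM (a b k : R) : 0 < a -> pos_pow (a * b) k = a `^ k * pos_pow b k.
Proof.
move=> a0; rewrite /pos_pow pmulr_rgt0//; case: ifPn => b0; last by rewrite mulr0.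
by rewrite powRM// ltW.
Qed.

(** For negative k the integrand is singular at q = 2. The fundamental theorem is applied on
    intervals stopping short of 2, where the bound 2 / (k + 1) is uniform, and monotone convergence
    fills the gap. *)
Lemma integral_powR_lty (k : R) : -1 < k ->
  (\int[mu]_(q in `[0%R, +oo[) (pos_pow (1 - q / 2) k)%:E < +oo)%E.
Proof.
move=> k1.
have k0 : 0 < k + 1 by lra.
pose D (n : nat) := `[0%R, 2 - n.+1%:R^-1 :> R]%classic : set M.
have mf : measurable_fun [set: M] (fun q : M => (pos_pow (1 - q / 2) k)%:E).
  apply/measurable_EFinP; apply: (measurableT_comp (measurable_pos_pow k)).
  by apply: measurable_funB => //; exact: measurable_funM.
have bound n : (\int[mu]_(q in D n) (pos_pow (1 - q / 2) k)%:E <= (2 / (k + 1))%:E)%E.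
  have n1 : 0 < n.+1%:R^-1 :> R by rewrite invr_gt0.
  have n2 : n.+1%:R^-1 <= 1 :> R by rewrite invf_le1// ler1n.
  rewrite /D; move: n1 n2; set e := n.+1%:R^-1 => n1 n2.
  pose F (q : R) := - (2 / (k + 1)) * (1 - q / 2) `^ (k + 1).
  have dF (q : R) : q < 2 -> is_derive q 1 F ((1 - q / 2) `^ k).
    move=> q2.
    have q3 : 0 < 1 - q / 2 by lra.
    have h : is_derive (1 - q / 2) 1 (@powR R ^~ (k + 1)) ((k + 1) * (1 - q / 2) `^ k).
      by have := is_derive_powR (k + 1) q3; rewrite addrK.
    have g : is_derive q 1 (fun q : R => 1 - q / 2) (- 2^-1).
      by apply: is_derive_eq; rewrite /GRing.scale /=; ring.
    have := is_deriveZ (- (2 / (k + 1))) (is_derive1_comp (g := fun q : R => 1 - q / 2) h g).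
    by move/is_derive_eq; apply; rewrite /GRing.scale /=; field; rewrite gt_eqF.
  have cF (q : R) : q < 2 -> {for q, continuous F}.
    move=> q2; apply/differentiable_continuous/derivable1_diffP.
    by have := dF _ q2 => ?; exact: ex_derive.
  rewrite (eq_integral (fun q : M => ((1 - q / 2) `^ k)%:E)); last first.
    move=> q; rewrite inE /= in_itv/= => /andP[q0 q1]; rewrite /pos_pow ifT//; lra.
  rewrite (@continuous_FTC2 R _ F).
  - rewrite -EFinB lee_fin /F mul0r subr0 powR1 mulr1 mulNr opprK.
    by rewrite gerDr oppr_le0 mulr_ge0 ?powR_ge0// divr_ge0// ltW.
  - lra.
  - apply: continuous_in_subspaceT => q; rewrite inE/= in_itv/= => /andP[q0 q1].
    apply: (@continuous_comp R R R (fun q => 1 - q / 2) (@powR R ^~ k)).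
      by apply: cvgB; [exact: cvg_cst|apply: cvgM; [exact: cvg_id|exact: cvg_cst]].
    by apply: continuous_powR; lra.
  - split.
    + move=> q /[!in_itv]/= /andP[q0 q1]; have /dF ? : q < 2 by lra.
      exact: ex_derive.
    + by apply: cvg_at_right_filter; apply: cF; lra.
    + by apply: cvg_at_left_filter; apply: cF; lra.
  - move=> q /[!in_itv]/= /andP[q0 q1]; have /dF ? : q < 2 by lra.
    by rewrite derive1E derive_val.
have DU : \bigcup_n D n = `[0%R, 2[%classic.
  apply/seteqP; split => q /=.
    case=> n _; rewrite /D /= !in_itv/= => /andP[-> h] /=.
    by apply: (le_lt_trans h); rewrite ltrBlDr ltrDl invr_gt0.
  rewrite in_itv/= => /andP[q0 q2].
  have e0 : 0 < 2 - q by lra.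
  have [n _ hn] := near_infty_natSinv_lt (PosNum e0).
  exists n => //; rewrite /D/= in_itv/= q0.
  by rewrite lerBrDr addrC -lerBrDr; apply: ltW; exact: hn n (leqnn n).
apply: (@le_lt_trans _ _ (2 / (k + 1))%:E); last exact: ltry.
have -> : (\int[mu]_(q in `[0%R, +oo[) (pos_pow (1 - q / 2) k)%:E
   = \int[mu]_(q in \bigcup_n D n) (pos_pow (1 - q / 2) k)%:E)%E.
  rewrite DU integral_mkcond [RHS]integral_mkcond; apply: eq_integral => q _.
  rewrite !patchE !mem_setE !in_itv/= andbT; case: (leP 0 q) => //= q0.
  by case: ltP => // q2; rewrite /pos_pow ifN// -leNgt; lra.
have cv : (\int[mu]_(q in D n) (pos_pow (1 - q / 2) k)%:E)%E @[n --> \oo] --> (\int[mu]_(q in \bigcup_n D n) (pos_pow (1 - q / 2) k)%:E)%E.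
  apply: ge0_nondecreasing_set_cvg_integral => //.
  - move=> n m nm; apply/subsetPset => q; rewrite /D /= !in_itv/= => /andP[-> h] /=.
    rewrite (le_trans h)// lerD2l lerN2 lef_pV2 ?posrE// ler_nat ltnS//.
  - by move=> n; exact: measurable_itv.
  - by move=> n; exact: measurable_funTS.
  - by move=> n q _; rewrite lee_fin pos_pow_ge0.
rewrite -(cvg_lim _ cv)//; apply: lime_le; first by apply/cvg_ex; eexists; exact: cv.
by apply: nearW => n; exact: bound.
Qed.

(* The constant [c_k], in the variable [q = |v|^2 = 2 (1 - eta)]. *)
Definition polytropic_constant (k : R) : \bar R :=
  ((2 * pi)%:E * \int[mu]_(q in `[0%R, +oo[) (Num.sqrt q * pos_pow (1 - q / 2) k)%:E)%E.

Lemma polytropic_constant_lty (k : R) : -1 < k -> (polytropic_constant k < +oo)%E.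
Proof.
move=> k1; rewrite /polytropic_constant lte_mul_pinfty//; first by rewrite lee_fin mulr_ge0// pi_ge0.
have mp : measurable_fun [set: M] (fun q : M => pos_pow (1 - q / 2) k).
  apply: (measurableT_comp (measurable_pos_pow k)).
  by apply: measurable_funB => //; exact: measurable_funM.
apply: (@le_lt_trans _ _ ((Num.sqrt 2)%:E * \int[mu]_(q in `[0%R, +oo[) (pos_pow (1 - q / 2) k)%:E)%E).
  rewrite -ge0_integralZl_EFin//; first last.
  - by apply/measurable_EFinP; exact: measurable_funTS.
  - by move=> q _; rewrite lee_fin pos_pow_ge0.
  apply: ge0_le_integral => //.
  - by move=> q _; rewrite lee_fin mulr_ge0 ?sqrtr_ge0// pos_pow_ge0.
  - apply/measurable_EFinP; apply: measurable_funTS; apply: measurable_funM => //.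
    exact: measurable_fun_sqrt.
  - by apply/measurable_EFinP; apply: measurable_funTS; apply: measurable_funM.
  - move=> q /= ; rewrite in_itv/= andbT => q0; rewrite -EFinM lee_fin.
    have [q2|q2] := ltP q 2.
      by rewrite ler_wpM2r ?pos_pow_ge0// ler_sqrt// ltW.
    by rewrite /pos_pow ifN ?mulr0// -leNgt; lra.
by rewrite lte_mul_pinfty// ?lee_fin ?sqrtr_ge0//; exact: integral_powR_lty.
Qed.

Lemma polytropic_constant_gt0 (k : R) : (0 < polytropic_constant k)%E.
Proof.
rewrite /polytropic_constant mule_gt0//; first by rewrite lte_fin mulr_gt0// pi_gt0.
have mp : measurable_fun [set: M] (fun q : M => pos_pow (1 - q / 2) k).
  apply: (measurableT_comp (measurable_pos_pow k)).
  by apply: measurable_funB => //; exact: measurable_funM.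
set f := (fun q : M => (Num.sqrt q * pos_pow (1 - q / 2) k)%:E).
(* A lower bound for (1 - q / 2)^k on [1/2, 1]: the base lies between 1/2 and 1, so the power is at
   least 2^(-k) for k >= 0 and at least 1 for k < 0. *)
pose c := Num.min 1 (2^-1 `^ k) : R.
have c0 : 0 < c by rewrite lt_min ltr01 powR_gt0.
have mfM : measurable_fun [set: M] f.
  by apply/measurable_EFinP; apply: measurable_funM => //; exact: measurable_fun_sqrt.
have lb : ((2^-1 * (2^-1 * c))%:E <= \int[mu]_(q in `[0%R, +oo[) f q)%E.
  apply: (@le_trans _ _ (\int[mu]_(q in `[(2^-1)%R, 1%R]) (2^-1 * c)%:E)%E).
    rewrite integral_cst//= lebesgue_measure_itv/= lte_fin ifT; last lra.
    by rewrite -EFinB -EFinM lee_fin; lra.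
  apply: (@le_trans _ _ (\int[mu]_(q in `[(2^-1)%R, 1%R]) f q)%E).
    apply: ge0_le_integral => //.
    - by move=> q _; rewrite lee_fin mulr_ge0// ltW.
    - exact: measurable_funTS.
    - move=> q; rewrite /= in_itv/= => /andP[q1 q2]; rewrite lee_fin.
      apply: ler_pM; rewrite ?(ltW c0)//.
        have -> : 2^-1 = Num.sqrt ((2^-1) ^+ 2) :> R by rewrite sqrtr_sqr ger0_norm.
        by rewrite ler_sqrt; nra.
      rewrite /pos_pow ifT; last lra.
      rewrite ge_min; have [k0|k0] := leP 0 k.
        by apply/orP; right; rewrite ge0_ler_powR// ?nnegrE; lra.
      have h : (1 - q / 2) `^ 0 <= (1 - q / 2) `^ k by apply: ger_powR; lra.
      by move: h; rewrite powRr0 => ->.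
  apply: ge0_subset_integral => //.
  - exact: measurable_funTS.
  - by move=> q _; rewrite lee_fin mulr_ge0 ?sqrtr_ge0// pos_pow_ge0.
  - by move=> q /=; rewrite !in_itv/= andbT => /andP[q1 _]; lra.
apply: lt_le_trans lb; rewrite lte_fin; by rewrite !mulr_gt0.
Qed.

(** Scaling q by a > 0 produces a from dq, a^(1/2) from sqrt q and a^k from the integrand, hence the
    exponent k + 3/2. For a <= 0 both sides vanish. *)
Lemma integral_polytrope (a k : R) : -1 < k ->
  (\int[leb3 R]_v (pos_pow (a - 2^-1 * enorm v ^+ 2) k)%:E
    = polytropic_constant k * (pos_pow a (k + 3 / 2))%:E)%E.
Proof.
move=> k1.
pose f (q : R) := pos_pow (a - 2^-1 * q) k.
have mf : measurable_fun [set: R] f.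
  apply: (measurableT_comp (measurable_pos_pow k)).
  by apply: measurable_funB => //; exact: measurable_funM.
transitivity (\int[leb3 R]_y (f (y.1.1 ^+ 2 + y.1.2 ^+ 2 + y.2 ^+ 2))%:E)%E.
  apply: eq_integral => v _; by rewrite /f /enorm sqr_sqrtr// !addr_ge0// sqr_ge0.
rewrite ge0_integral_radial//; last by move=> q; exact: pos_pow_ge0.
rewrite /polytropic_constant -muleA; congr (_ * _)%E.
have -> : pos_pow a (k + 3 / 2) = if 0 < a then a `^ (k + 3 / 2) else 0 by [].
case: ltP => a0; last first.
  rewrite mule0; apply: integral0_eq => q; rewrite /= in_itv/= andbT => q0.
  rewrite /f /pos_pow ifN ?mulr0// -leNgt; lra.
have mg b : measurable_fun [set: M] (fun q : M => (Num.sqrt q * pos_pow (b - 2^-1 * q) k)%:E).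
  apply/measurable_EFinP; apply: measurable_funM; first exact: measurable_fun_sqrt.
  apply: (measurableT_comp (measurable_pos_pow k)).
  by apply: measurable_funB => //; exact: measurable_funM.
rewrite integral_mkcond -(@ge0_integral_affine R a 0)//; first last.
- move=> q; rewrite patchE; case: ifP => // _.
  by rewrite lee_fin mulr_ge0 ?sqrtr_ge0// pos_pow_ge0.
- by apply: (measurable_restrictT _ _).1 => //; exact: (measurable_funTS (mg a)).
rewrite -ge0_integralZl_EFin//; first last.
- exact: ltW.
- apply: (measurableT_comp (f := (fun q : M => (Num.sqrt q * f q)%:E) \_ `[0%R, +oo[) (g := fun q : M => a * q + 0)).
    by apply: (measurable_restrictT _ _).1 => //; apply: measurable_funTS; exact: mg.
  by apply: measurable_funD => //; exact: measurable_funM.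
- move=> q _; rewrite patchE; case: ifP => // _.
  by rewrite lee_fin mulr_ge0 ?sqrtr_ge0// pos_pow_ge0.
have mg1 : measurable_fun [set: M] ((fun q : M => (Num.sqrt q * pos_pow (1 - q / 2) k)%:E) \_ `[0%R, +oo[).
  apply: (measurable_restrictT _ _).1 => //; apply: measurable_funTS.
  by have := mg 1; under eq_fun do rewrite [2^-1 * _]mulrC.
have g1 : forall q : M, [set: M] q -> (0 <= ((fun q : M => (Num.sqrt q * pos_pow (1 - q / 2) k)%:E) \_ `[0%R, +oo[) q)%E.
  by move=> q _; rewrite patchE; case: ifP => // _; rewrite lee_fin mulr_ge0 ?sqrtr_ge0// pos_pow_ge0.
rewrite [RHS]muleC [in RHS]integral_mkcond.
rewrite -[RHS](ge0_integralZl_EFin mu measurableT g1 mg1 (powR_ge0 _ _)).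
apply: eq_integral => q _; rewrite !patchE addr0 !mem_setE !in_itv/= !andbT pmulr_rge0//.
case: ifP => q0; last by rewrite !mule0.
rewrite -!EFinM /f; congr EFin.
have -> : a - 2^-1 * (a * q) = a * (1 - q / 2) by field.
rewrite sqrtrM ?(ltW a0)// pos_powM// powRD; last first.
  by rewrite (gt_eqF a0) implybT.
have -> : a `^ (3 / 2) = a * Num.sqrt a.
  have -> : 3 / 2 = 1 + 2^-1 :> R by field.
  by rewrite powRD ?(gt_eqF a0) ?implybT// powRr1 ?(ltW a0)// powR12_sqrt ?(ltW a0).
ring.
Qed.

End velocity.

(** * The radial Poisson operator *)

Section volterra.
Variable R : realType.
Local Notation mu := (@lebesgue_measure R).
Local Notation M := (measurableTypeR R).
Implicit Types (F : R -> R) (Q : R).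

Lemma bounded_itv_integrable F (a b c : R) :
  measurable_fun [set: R] F -> (forall q, `|F q| <= c) ->
  mu.-integrable `[a, b] (EFin \o F).
Proof.
move=> mF Fc; apply: measurable_bounded_integrable => //.
- rewrite [ltLHS](_ : _ = lebesgue_measure (`[a, b]%classic : set R))//.
  by rewrite lebesgue_measure_itv/=; case: ifP => // _; rewrite -EFinB ltry.
- exact: measurable_funTS.
- exists c; split => //; first exact: num_real.
  by move=> t ct q _; exact: le_trans (Fc q) (ltW ct).
Qed.

Lemma Rintegral_cst_itv (a b d : R) : a <= b ->
  \int[mu]_(q in `[a, b]) d = d * (b - a).
Proof.
move=> ab; rewrite Rintegral_cst//= lebesgue_measure_itv/= lte_fin.
case: ltP => [_|ba]; first by rewrite -EFinB.
have -> : a = b by apply/eqP; rewrite eq_le ab ba.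
by rewrite subrr.
Qed.

Lemma integrable_cst_itv (a b d : R) : mu.-integrable `[a, b] (EFin \o (fun=> d)).
Proof. by apply: (@bounded_itv_integrable _ a b `|d|). Qed.

(* [u x = volterra F (|x|^2)] is the radial solution of [Delta u = 2 F (|x|^2)],
   [u 0 = 0]. For [Q <= 0] the kernel is [1], but the integral is over a null
   set. *)
Definition volterra_kernel (Q q : R) : R := 1 - Num.sqrt q / Num.sqrt Q.
Definition volterra F Q : R :=
  \int[mu]_(q in `[0, Q]) (volterra_kernel Q q * F q).

Lemma volterra_kernel_ge0 Q q : q <= Q -> 0 <= volterra_kernel Q q.
Proof.
move=> qQ; have [Q0|Q0] := ltP 0 Q; last first.
  by rewrite /volterra_kernel (ler0_sqrtr Q0) invr0 mulr0 subr0.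
by rewrite subr_ge0 ler_pdivrMr ?sqrtr_gt0// mul1r ler_sqrt// ltW.
Qed.

Lemma volterra_kernel_le1 Q q : volterra_kernel Q q <= 1.
Proof. by rewrite lerBlDr lerDl divr_ge0// sqrtr_ge0. Qed.

Lemma volterra_kernel_le Q Q' q : 0 < Q -> Q <= Q' ->
  volterra_kernel Q q <= volterra_kernel Q' q.
Proof.
move=> Q0 QQ; rewrite lerD2l lerN2 ler_wpM2l ?sqrtr_ge0// lef_pV2 ?posrE ?sqrtr_gt0//.
  by rewrite ler_sqrt// (le_trans (ltW Q0)).
exact: lt_le_trans QQ.
Qed.

Lemma volterra_le0 F Q : Q <= 0 -> volterra F Q = 0.
Proof.
rewrite le_eqVlt => /predU1P[->|Q0]; first by rewrite /volterra set_itv1 Rintegral_set1.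
by rewrite /volterra set_itv_ge ?bnd_simp -?ltNge// Rintegral_set0.
Qed.

Section fixed_integrand.
Variables (F : R -> R) (c : R).
Hypothesis mF : measurable_fun [set: R] F.
Hypothesis F0 : forall q, 0 <= F q.
Hypothesis Fc : forall q, F q <= c.

Let c0 : 0 <= c. Proof. exact: le_trans (F0 0) (Fc 0). Qed.

Lemma measurable_volterra_integrand Q :
  measurable_fun [set: R] (fun q => volterra_kernel Q q * F q).
Proof.
apply: measurable_funM => //; apply: measurable_funB => //.
apply: measurable_funM => //.
by apply: continuous_measurable_fun; exact: sqrt_continuous.
Qed.

Lemma integrable_volterra Q (a b : R) : 0 <= a -> b <= Q ->
  mu.-integrable `[a, b] (EFin \o (fun q => volterra_kernel Q q * F q)).
Proof.
move=> a0 bQ; apply: measurable_bounded_integrable => //.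
- rewrite [ltLHS](_ : _ = lebesgue_measure (`[a, b]%classic : set R))//.
  by rewrite lebesgue_measure_itv/=; case: ifP => // _; rewrite -EFinB ltry.
- exact: measurable_funTS (measurable_volterra_integrand Q).
- exists c; split => //; first exact: num_real.
  move=> t ct q /= /[!in_itv]/= /andP[aq qb]; apply: le_trans (ltW ct).
  have k0 : 0 <= volterra_kernel Q q by apply: volterra_kernel_ge0; exact: le_trans bQ.
  rewrite ger0_norm ?mulr_ge0//; apply: (le_trans _ (Fc q)).
  by rewrite ler_piMl// volterra_kernel_le1.
Qed.

Lemma volterra_ge0 Q : 0 <= volterra F Q.
Proof.
apply: Rintegral_ge0 => q /= /[!in_itv]/= /andP[q0 qQ].
by rewrite mulr_ge0// volterra_kernel_ge0.
Qed.

Lemma volterra_le Q : 0 <= Q -> volterra F Q <= c * Q.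
Proof.
move=> Q0; rewrite -[X in _ * X]subr0 -Rintegral_cst_itv//.
apply: le_Rintegral => //.
- exact: integrable_volterra.
- exact: integrable_cst_itv.
- move=> q /= /[!in_itv]/= /andP[q0 qQ]; apply: (le_trans _ (Fc q)).
  by rewrite ler_piMl// volterra_kernel_le1.
Qed.

Lemma volterra_split Q (a : R) : 0 <= a -> a <= Q ->
  volterra F Q = \int[mu]_(q in `[0, a]) (volterra_kernel Q q * F q)
    + \int[mu]_(q in `]a, Q]) (volterra_kernel Q q * F q).
Proof.
move=> a0 aQ; have := @Rintegral_itvB R (fun q => volterra_kernel Q q * F q) (BLeft 0) (BRight Q) a.
rewrite /volterra => <-; first by ring.
- exact: integrable_volterra.
- by rewrite bnd_simp.
- by rewrite bnd_simp.
Qed.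

Lemma volterra_homo Q Q' : Q <= Q' -> volterra F Q <= volterra F Q'.
Proof.
move=> QQ; have [Q0|Q0] := ltP 0 Q; last by rewrite volterra_le0// volterra_ge0.
rewrite (@volterra_split Q' Q)// ?(ltW Q0)//.
rewrite -[leLHS]addr0 lerD//; last first.
  apply: Rintegral_ge0 => q /= /[!in_itv]/= /andP[qQ qQ'].
  by rewrite mulr_ge0// volterra_kernel_ge0.
apply: le_Rintegral => //.
- exact: integrable_volterra.
- exact: integrable_volterra.
- by move=> q _; rewrite ler_wpM2r// volterra_kernel_le.
Qed.

(** One c comes from the strip between Q and Q', where the kernel is at most 1. The other comes from
    the growth of the kernel on [0, Q], which is at most (Q' - Q) / Q' pointwise. *)
Lemma volterra_lipschitz Q Q' : 0 <= Q -> Q <= Q' ->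
  volterra F Q' <= volterra F Q + 2 * c * (Q' - Q).
Proof.
rewrite le_eqVlt => /predU1P[<- Q'0|Q0 QQ].
  rewrite [volterra F 0]volterra_le0// add0r subr0 (le_trans (volterra_le Q'0))//.
  have : 0 <= c * Q' by rewrite mulr_ge0.
  by rewrite -mulrA; lra.
have Q'0 : 0 < Q' by exact: lt_le_trans QQ.
rewrite (@volterra_split Q' Q)// ?(ltW Q0)//.
have -> : volterra F Q + 2 * c * (Q' - Q) = (volterra F Q + c * (Q' - Q)) + c * (Q' - Q) by ring.
apply: lerD; last first.
  rewrite Rintegral_itv_obnd_cbnd; last first.
    apply: (@integrableS _ _ _ mu `[Q, Q']) => //; first exact: subset_itv_oc_cc.
    exact: integrable_volterra (ltW Q0) _.
  rewrite -Rintegral_cst_itv//; apply: le_Rintegral => //.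
  - exact: integrable_volterra (ltW Q0) _.
  - exact: integrable_cst_itv.
  - move=> q /= /[!in_itv]/= /andP[q0 qQ]; apply: (le_trans _ (Fc q)).
    by rewrite ler_piMl// volterra_kernel_le1.
apply: (@le_trans _ _ (volterra F Q + \int[mu]_(q in `[0, Q]) (c * (Q' - Q) / Q'))); last first.
  rewrite lerD2l Rintegral_cst_itv// ?(ltW Q0)// subr0 -mulrA ler_piMr//.
    by rewrite mulr_ge0// subr_ge0.
  by rewrite mulrC ler_pdivrMr// mul1r.
rewrite /volterra -RintegralD//; [|exact: integrable_volterra|exact: integrable_cst_itv].
apply: le_Rintegral => //.
- exact: integrable_volterra.
- exact: (integrableD _ (integrable_volterra (lexx 0) (lexx Q)) (integrable_cst_itv _ _ _)).
- move=> q /= /[!in_itv]/= /andP[q0 qQ]; rewrite -lerBlDl -mulrBl.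
  have sQ : 0 < Num.sqrt Q by rewrite sqrtr_gt0.
  have sQ' : 0 < Num.sqrt Q' by rewrite sqrtr_gt0.
  have hQ : Num.sqrt Q ^+ 2 = Q by rewrite sqr_sqrtr// ltW.
  have hQ' : Num.sqrt Q' ^+ 2 = Q' by rewrite sqr_sqrtr// ltW.
  have sq : Num.sqrt q <= Num.sqrt Q by rewrite ler_sqrt// ltW.
  have sQQ : Num.sqrt Q <= Num.sqrt Q' by rewrite ler_sqrt// ltW.
  rewrite [leRHS](_ : _ = (Q' - Q) / Q' * c); last by ring.
  apply: ler_pM => //.
    by rewrite subr_ge0 volterra_kernel_le.
  rewrite /volterra_kernel.
  set s := Num.sqrt Q in sQ sq sQQ hQ *; set s' := Num.sqrt Q' in sQ' sQQ hQ' *.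
  rewrite ler_pdivlMr//.
  have -> : (1 - Num.sqrt q / s' - (1 - Num.sqrt q / s)) * Q' = (Num.sqrt q / s) * (s' * (s' - s)).
    by rewrite -hQ'; field; rewrite !gt_eqF.
  have h1 : Num.sqrt q / s <= 1 by rewrite ler_pdivrMr// mul1r.
  have h2 : 0 <= s' * (s' - s) by rewrite mulr_ge0 ?subr_ge0// ltW.
  apply: (le_trans (ler_wpM2r h2 h1)); rewrite mul1r -hQ -hQ'; nra.
Qed.

Lemma continuous_volterra : continuous (volterra F).
Proof.
have lip Q Q' : Q <= Q' -> `|volterra F Q' - volterra F Q| <= 2 * c * (Q' - Q).
  move=> QQ; rewrite ger0_norm ?subr_ge0 ?volterra_homo//.
  have [Q0|Q0] := leP 0 Q; first by rewrite lerBlDl volterra_lipschitz.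
  have cp : 0 <= 2 * c * (Q' - Q) by rewrite !mulr_ge0// subr_ge0.
  have [Q'0|Q'0] := leP 0 Q'; last by rewrite !volterra_le0 ?subr0// ltW.
  rewrite (volterra_le0 F (ltW Q0)) subr0; have := volterra_le Q'0.
  move/le_trans; apply.
  have : 0 <= c * Q' by rewrite mulr_ge0.
  have : 0 <= c * (- Q) by rewrite mulr_ge0// oppr_ge0 ltW.
  nra.
move=> Q; apply/cvgrPdist_le => e e0.
have d0 : 0 < e / (2 * c + 1) by rewrite divr_gt0// ltr_wpDl// mulr_ge0.
near=> Q'.
have h : `|Q - Q'| <= e / (2 * c + 1).
  by near: Q'; apply: (@cvgr_dist_le _ _ _ _ _ (fun x : R => x) Q) => //; exact: cvg_id.
have h2 : (2 * c + 1) * `|Q - Q'| <= e by rewrite mulrC -ler_pdivlMr// ltr_wpDl// mulr_ge0.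
have h3 := normr_ge0 (Q - Q').
apply: le_trans h2; rewrite mulrDl mul1r -[leLHS]addr0 lerD//.
have [QQ|QQ] := leP Q Q'.
  by rewrite distrC (le_trans (lip _ _ QQ))// distrC ger0_norm ?subr_ge0.
by rewrite (le_trans (lip _ _ (ltW QQ)))// ger0_norm ?subr_ge0 ?(ltW QQ).
Unshelve. all: by end_near. Qed.

End fixed_integrand.

Lemma volterra_le_homo F F' (c : R) Q :
  measurable_fun [set: R] F -> measurable_fun [set: R] F' ->
  (forall q, 0 <= F q) -> (forall q, F q <= F' q) -> (forall q, F' q <= c) ->
  volterra F Q <= volterra F' Q.
Proof.
move=> mF mF' F0 FF F'c; apply: le_Rintegral => //.
- by apply: (@integrable_volterra F c) => // q; exact: le_trans (F'c q).
- by apply: (@integrable_volterra F' c) => // q; exact: le_trans (FF q).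
- move=> q /= /[!in_itv]/= /andP[q0 qQ].
  by rewrite ler_wpM2l// volterra_kernel_ge0.
Qed.

(** The kernel vanishes at q = Q, so the right endpoint does not count. *)
Lemma eq_volterra F F' Q : {in `[0, Q[, F =1 F'} ->
  volterra F Q = volterra F' Q.
Proof.
move=> FF; have [Q0|Q0] := ltP 0 Q; last by rewrite !volterra_le0.
apply: eq_Rintegral => q; rewrite inE/= in_itv/= => /andP[q0 qQ].
have [qQ'|Qq] := ltP q Q; first by rewrite FF// in_itv/= q0.
have -> : q = Q by apply/eqP; rewrite eq_le qQ Qq.
by rewrite /volterra_kernel divff ?subrr ?mul0r// gt_eqF// sqrtr_gt0.
Qed.

Lemma le_Rintegral_subset (A B : set M) (h : M -> R) : measurable A -> measurable B ->
  A `<=` B -> mu.-integrable B (EFin \o h) -> (forall q, B q -> 0 <= h q) ->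
  \int[mu]_(q in A) h q <= \int[mu]_(q in B) h q.
Proof.
move=> mA mB AB ih h0.
have ihA : mu.-integrable A (EFin \o h) by apply: integrableS ih.
apply: fine_le.
- exact: integrable_fin_num ihA.
- exact: integrable_fin_num ih.
- apply: ge0_subset_integral => //; first exact: measurable_int ih.
Qed.

Lemma volterra_ge F (c d Q : R) : measurable_fun [set: R] F ->
  (forall q, 0 <= F q) -> (forall q, F q <= c) -> 0 < Q -> 0 <= d ->
  (forall q, q <= Q -> d <= F q) -> d * Q / 8 <= volterra F Q.
Proof.
move=> mF F0 Fc Q0 d0 dF.
have Q4 : 0 <= Q / 4 by lra.
apply: (@le_trans _ _ (\int[mu]_(q in `[0, Q / 4]) (2^-1 * d))).
  by rewrite Rintegral_cst_itv//; lra.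
apply: (@le_trans _ _ (\int[mu]_(q in `[0, Q / 4]) (volterra_kernel Q q * F q))).
  apply: le_Rintegral => //.
  - exact: integrable_cst_itv.
  - by apply: (integrable_volterra mF F0 Fc) => //; lra.
  - move=> q /= /[!in_itv]/= /andP[q0 qQ]; apply: ler_pM => //; last by apply: dF; lra.
    have sQ : 0 < Num.sqrt Q by rewrite sqrtr_gt0.
    rewrite /volterra_kernel lerBrDr -lerBrDl ler_pdivrMr//.
    have : Num.sqrt q <= Num.sqrt ((Num.sqrt Q / 2) ^+ 2).
      by rewrite ler_sqrt ?sqr_ge0// exprMn sqr_sqrtr ?(ltW Q0)//; lra.
    by rewrite sqrtr_sqr ger0_norm ?divr_ge0 ?(ltW sQ)//; lra.
apply: le_Rintegral_subset => //.
- by move=> q /=; rewrite !in_itv/=; lra.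
- exact: (integrable_volterra mF F0 Fc).
- by move=> q /= /[!in_itv]/= /andP[q0 qQ]; rewrite mulr_ge0// volterra_kernel_ge0.
Qed.

(** The mass inside the unit ball still produces a potential drop of order 1 / |x| far away.
    Comparing Q with 4 Q makes the difference of kernels exactly sqrt q / (2 sqrt Q), and no limit
    at infinity is needed: for a solution positive at 4 Q, the drop bounds its value at Q from
    below. Only the range [1/4, 1] is kept, where sqrt q >= 1/2. *)
Lemma volterra_increment F (c w Q : R) : measurable_fun [set: R] F ->
  (forall q, 0 <= F q) -> (forall q, F q <= c) -> 1 <= Q -> 0 <= w ->
  (forall q, q <= 1 -> w <= F q) ->
  w / 8 / Num.sqrt Q <= volterra F (4 * Q) - volterra F Q.
Proof.
move=> mF F0 Fc Q1 w0 wF.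
have Q0 : 0 < Q by lra.
have sQ : 0 < Num.sqrt Q by rewrite sqrtr_gt0.
have s4 : Num.sqrt (4 * Q) = 2 * Num.sqrt Q.
  have -> : 4 * Q = (2 * Num.sqrt Q) ^+ 2 by rewrite exprMn sqr_sqrtr ?(ltW Q0)//; ring.
  by rewrite sqrtr_sqr ger0_norm// mulr_ge0// ltW.
have i1 := integrable_volterra mF F0 Fc (lexx 0) (lexx Q).
have i4 : mu.-integrable `[0, Q] (EFin \o (fun q => volterra_kernel (4 * Q) q * F q)).
  by apply: (integrable_volterra mF F0 Fc) => //; lra.
have i41 := integrableB _ i4 i1.
have kE q : volterra_kernel (4 * Q) q * F q - volterra_kernel Q q * F q
    = Num.sqrt q / (2 * Num.sqrt Q) * F q.
  by rewrite /volterra_kernel s4; field; rewrite gt_eqF.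
apply: (@le_trans _ _ (\int[mu]_(q in `[0, Q])
    (volterra_kernel (4 * Q) q * F q - volterra_kernel Q q * F q))); last first.
  rewrite RintegralB// lerB// /volterra; apply: le_Rintegral_subset => //.
  - by move=> q /=; rewrite !in_itv/=; lra.
  - exact: (integrable_volterra mF F0 Fc).
  - by move=> q /= /[!in_itv]/= /andP[q0 qQ]; rewrite mulr_ge0// volterra_kernel_ge0.
apply: (@le_trans _ _ (\int[mu]_(q in `[4^-1, 1])
    (volterra_kernel (4 * Q) q * F q - volterra_kernel Q q * F q))); last first.
  apply: le_Rintegral_subset => //.
  - by move=> q /=; rewrite !in_itv/=; lra.
  - exact: i41.
  - move=> q _; by rewrite kE; apply: mulr_ge0.
apply: (@le_trans _ _ (\int[mu]_(q in `[4^-1, 1]) (w / 4 / Num.sqrt Q))).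
  rewrite Rintegral_cst_itv; last lra.
  have : 0 <= w / Num.sqrt Q by rewrite divr_ge0// ltW.
  have -> : w / 8 / Num.sqrt Q = w / Num.sqrt Q * 8^-1 by field; rewrite gt_eqF.
  have -> : w / 4 / Num.sqrt Q = w / Num.sqrt Q * 4^-1 by field; rewrite gt_eqF.
  by nra.
apply: le_Rintegral => //.
- exact: integrable_cst_itv.
- apply: (@integrableS _ _ _ mu `[0, Q]) => //; last exact: i41.
  by move=> q /=; rewrite !in_itv/=; lra.
- move=> q /= /[!in_itv]/= /andP[q0 q1]; rewrite kE.
  have -> : w / 4 / Num.sqrt Q = 2^-1 / (2 * Num.sqrt Q) * w by field; rewrite gt_eqF.
  apply: ler_pM => //; rewrite ?wF// ?divr_ge0 ?mulr_ge0 ?(ltW sQ)//.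
  rewrite ler_pM2r ?invr_gt0 ?mulr_gt0//.
  have -> : 2^-1 = Num.sqrt ((2^-1) ^+ 2) :> R by rewrite sqrtr_sqr ger0_norm.
  by rewrite ler_sqrt; lra.
Qed.

End volterra.

(** * The Lane-Emden equation *)

Section lane_emden.
Variable R : realType.
Local Notation mu := (@lebesgue_measure R).
Variable g : R -> R.
Hypothesis g_homo : {homo g : x y / x <= y}.
Hypothesis g_ge0 : forall x, 0 <= g x.
Hypothesis g_le1 : forall x, x <= 1 -> g x <= 1.
Hypothesis g_lip : forall e, 0 < e ->
  exists2 L, 0 < L & forall x y, e <= x -> x <= y -> y <= 1 -> g y - g x <= L * (y - x).

(** The class has to be stable under pointwise infima, which may destroy continuity; monotonicity
    survives and makes [g \o y] measurable. No lower bound is imposed because solutions may become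
    negative. *)
Definition decreasing_below1 (y : R -> R) :=
  {homo y : q r / q <= r >-> r <= q} /\ (forall q, y q <= 1).

Lemma nonincreasing_measurable (F : R -> R) :
  {homo F : q r / q <= r >-> r <= q} -> measurable_fun [set: R] F.
Proof.
move=> dF; rewrite (_ : F = (fun q => - (- F q))); last by apply/funext => q; rewrite opprK.
apply: measurable_funN; apply: nondecreasing_measurable => // x y xy.
by rewrite lerN2 dF.
Qed.

Let gy_homo (y : R -> R) : decreasing_below1 y -> {homo g \o y : q r / q <= r >-> r <= q}.
Proof. by move=> [dy _] q r qr; rewrite /= g_homo// dy. Qed.

Let gy_meas y : decreasing_below1 y -> measurable_fun [set: R] (g \o y).
Proof. by move=> Dy; apply: nonincreasing_measurable; exact: gy_homo. Qed.

Let gy_ge0 (y : R -> R) q : 0 <= (g \o y) q. Proof. exact: g_ge0. Qed.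

Let gy_le1 y q : decreasing_below1 y -> (g \o y) q <= 1.
Proof. by move=> [_ y1]; exact: g_le1. Qed.

Definition emden (y : R -> R) (Q : R) : R := 1 - volterra (g \o y) Q.

Lemma emden_decreasing y : decreasing_below1 y -> decreasing_below1 (emden y).
Proof.
move=> Dy; split => [q r qr|q].
  rewrite lerD2l lerN2; exact: (volterra_homo (gy_meas Dy) (gy_ge0 y) (fun z => gy_le1 z Dy) qr).
by rewrite lerBlDr lerDl; exact: volterra_ge0.
Qed.

Lemma emden_antitone y z : decreasing_below1 y -> decreasing_below1 z ->
  (forall q, y q <= z q) -> forall q, emden z q <= emden y q.
Proof.
move=> Dy Dz yz q; rewrite lerD2l lerN2; apply: (@volterra_le_homo R _ _ 1) => //.
- exact: gy_meas.
- exact: gy_meas.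
- by move=> r; exact: g_homo.
- by move=> r; exact: gy_le1.
Qed.

(** The bound does not depend on [y], so the pointwise infimum over all pre-fixed points is
    finite. *)
Lemma emden_ge y Q : decreasing_below1 y -> 1 - `|Q| <= emden y Q.
Proof.
move=> Dy; rewrite lerD2l lerN2; have [Q0|Q0] := leP 0 Q; last first.
  by rewrite volterra_le0 ?normr_ge0// ltW.
have := volterra_le (gy_meas Dy) (gy_ge0 y) (fun z => gy_le1 z Dy) Q0.
by rewrite mul1r ger0_norm.
Qed.

Lemma emden2_homo y z : decreasing_below1 y -> decreasing_below1 z ->
  (forall q, y q <= z q) -> forall q, emden (emden y) q <= emden (emden z) q.
Proof.
move=> Dy Dz yz; have DKy := emden_decreasing Dy; have DKz := emden_decreasing Dz.
by apply: (emden_antitone DKz DKy); exact: (emden_antitone Dy Dz yz).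
Qed.

(* [emden] is antitone, so its square is monotone; its least pre-fixed point b
   (among non-increasing functions bounded by 1) and a = emden b satisfy
   a = emden b and b = emden a. *)
Lemma emden_cycle : exists a b : R -> R, [/\ decreasing_below1 a, decreasing_below1 b,
  (forall q, b q <= a q), (forall q, a q = emden b q) & (forall q, b q = emden a q)].
Proof.
pose P := [set y : R -> R | decreasing_below1 y /\ forall q, emden (emden y) q <= y q].
have P1 : P (fun=> 1).
  split; first by split.
  by move=> q; have [_] := emden_decreasing (emden_decreasing (conj (fun _ _ _ => lexx 1) (fun=> lexx 1) : decreasing_below1 (fun=> 1))); exact.
pose b (q : R) := inf [set y q | y in P].
have hlb q : has_inf [set y q | y in P].
  split; first by exists 1; exists (fun=> 1).
  exists (1 - `|q|) => _ [y [Dy hy] <-]; apply: le_trans (hy q).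
  by apply: emden_ge; exact: emden_decreasing.
have b_le y q : P y -> b q <= y q.
  move=> Py; apply: ge_inf; first by have [] := hlb q.
  by exists y.
have le_b q t : (forall y, P y -> t <= y q) -> t <= b q.
  move=> ht; apply: lb_le_inf; first by have [] := hlb q.
  by move=> _ [y Py <-]; exact: ht.
have Db : decreasing_below1 b.
  split => [q r qr|q]; last exact: (b_le (fun=> 1)).
  apply: le_b => y Py; apply: (le_trans (b_le _ _ Py)).
  by have [[dy _] _] := Py; exact: dy.
have DKb := emden_decreasing Db.
have DKKb := emden_decreasing DKb.
have KKb_le q : emden (emden b) q <= b q.
  apply: le_b => y Py; have [Dy hy] := Py; apply: le_trans (hy q).
  exact: (emden2_homo Db Dy (fun r => b_le y r Py)).
have b_KK q : b q <= emden (emden b) q.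
  apply: b_le; split; first exact: DKKb.
  exact: (emden2_homo DKKb Db KKb_le).
have bE : b = emden (emden b).
  by apply/funext => q; apply/eqP; rewrite eq_le b_KK KKb_le.
exists (emden b), b; split => // q; last by rewrite {1}bE.
(* The square of [emden] fixes [b], hence also [emden b], which is therefore a pre-fixed point and
   lies above the least one. *)
by apply: b_le; split; [exact: DKb|move=> r; rewrite -bE].
Qed.

Section cycle.
Variables a b : R -> R.
Hypotheses (Da : decreasing_below1 a) (Db : decreasing_below1 b)
  (ba : forall q, b q <= a q) (aE : forall q, a q = emden b q)
  (bE : forall q, b q = emden a q).

Lemma cycle_continuous : continuous b.
Proof.
have -> : b = fun q => 1 - volterra (g \o a) q by apply/funext => q; rewrite bE.
move=> q; apply: cvgB; first exact: cvg_cst.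
apply: (@continuous_volterra R _ 1) => //; first exact: gy_meas.
by move=> r; exact: gy_le1.
Qed.

Lemma cycle0 q : q <= 0 -> b q = 1.
Proof. by move=> q0; rewrite bE /emden volterra_le0// subr0. Qed.

(* Gronwall: iterating a - b <= L \int (a - b) halves the constant in the bound
   a - b <= C exp (2 L q). *)
Lemma cycle_eq Q : 0 < b Q -> forall q, 0 <= q <= Q -> a q = b q.
Proof.
(* As [b] is non-increasing and below [a], both take values in [b Q, 1] on [0, Q], and there [g] is
   Lipschitz. *)
move=> bQ; have [L L0 hL] := g_lip bQ.
have key (m : nat) : forall q, 0 <= q <= Q -> a q - b q <= 2^-1 ^+ m * expR (2 * L * q).
  elim: m => [|m IH] q /andP[q0 qQ].
    rewrite expr0 mul1r (@le_trans _ _ 1)//; last first.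
      by rewrite -expR0 ler_expR !mulr_ge0// ltW.
    have a1 := Da.2 q; have b0 : 0 < b q by apply: (lt_le_trans bQ); exact: Db.1.
    lra.
  have rQ r : r \in `[0, q] -> 0 <= r <= Q.
    by rewrite in_itv/= => /andP[r0 rq]; rewrite r0 (le_trans rq).
  have ia := integrable_volterra (gy_meas Da) (gy_ge0 a) (fun r => gy_le1 r Da) (lexx 0) (lexx q).
  have ib := integrable_volterra (gy_meas Db) (gy_ge0 b) (fun r => gy_le1 r Db) (lexx 0) (lexx q).
  pose h (r : R) := L * 2^-1 ^+ m * expR (2 * L * r).
  pose H (r : R) := 2^-1 ^+ m.+1 * expR (2 * L * r).
  have dH (r : R) : is_derive r 1 H (h r).
    have g1 : is_derive r 1 (fun r : R => 2 * L * r) (2 * L).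
      by apply: is_derive_eq; rewrite /GRing.scale /=; ring.
    have := is_deriveZ (2^-1 ^+ m.+1) (is_derive1_comp (g := fun r : R => 2 * L * r) (is_derive_expR _) g1).
    by move/is_derive_eq; apply; rewrite /h /GRing.scale /= exprS; field.
  have ch : continuous h.
    move=> r; apply: cvgM; first exact: cvg_cst.
    apply: (@continuous_comp R R R (fun r => 2 * L * r) expR); last exact: continuous_expR.
    by apply: cvgM; [exact: cvg_cst|exact: cvg_id].
  have cH : continuous H.
    by move=> r; apply/differentiable_continuous/derivable1_diffP; exact: ex_derive.
  have ih : mu.-integrable `[0, q] (EFin \o h).
    apply: continuous_compact_integrable; first exact: segment_compact.
    exact: continuous_subspaceT.
  have -> : a q - b q = \int[mu]_(r in `[0, q])
      (volterra_kernel q r * (g \o a) r - volterra_kernel q r * (g \o b) r).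
    by rewrite RintegralB// aE bE /emden /volterra; ring.
  apply: (@le_trans _ _ (\int[mu]_(r in `[0, q]) h r)).
    apply: le_Rintegral => //.
      exact: (integrableB _ ia ib).
    move=> r /= rI; have /andP[r0 rQ'] := rQ _ rI.
    have rq : r <= q by move: rI; rewrite in_itv/= => /andP[].
    rewrite -mulrBr.
    have gab : 0 <= g (a r) - g (b r) by rewrite subr_ge0 g_homo.
    apply: (@le_trans _ _ (g (a r) - g (b r))).
      by rewrite ler_piMl// volterra_kernel_le1.
    apply: (le_trans (hL _ _ _ (ba r) (Da.2 r))); first exact: Db.1.
    by rewrite /h -mulrA ler_wpM2l ?(ltW L0)// IH// r0.
  rewrite /Rintegral; have := q0; rewrite le_eqVlt => /predU1P[<-|q0'].
    by rewrite set_itv1 integral_set1 mulr_ge0 ?expR_ge0// exprn_ge0.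
  rewrite (@continuous_FTC2 R _ H)//=.
  - by rewrite /H gerBl mulr_ge0 ?expR_ge0// exprn_ge0.
  - exact: continuous_subspaceT.
  - split.
    + by move=> r _; exact: ex_derive.
    + by apply: cvg_at_right_filter; exact: cH.
    + by apply: cvg_at_left_filter; exact: cH.
  - by move=> r _; rewrite derive1E derive_val.
move=> q qQ; apply/eqP; rewrite eq_le ba andbT -subr_le0.
have cv : 2^-1 ^+ m * expR (2 * L * q) @[m --> \oo] --> (0 : R).
  rewrite -[X in _ --> X](mul0r (expR (2 * L * q))).
  by apply: cvgMl; apply: cvg_expr; rewrite ger0_norm// invf_lt1// ltr1n.
rewrite -(cvg_lim _ cv)//; apply: limr_ge; first by apply/cvg_ex; eexists; exact: cv.
by apply: nearW => m; exact: key.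
Qed.

(* Positive solutions on the whole half line satisfy b >= c / sqrt Q, and then
   the equation forces b <= 1 - C Q^(1 - n/2), which is negative eventually. *)
Lemma cycle_vanishes (n : R) : 0 <= n -> n < 2 ->
  (forall x, 0 < x -> x <= 1 -> x `^ n <= g x) ->
  exists2 Q, 0 < Q & b Q <= 0.
Proof.
move=> n0 n2 gn; apply: contrapT => hn.
have bpos q : 0 < b q.
  have [q0|q0] := leP q 0; first by rewrite cycle0.
  by rewrite ltNge; apply/negP => bq; apply: hn; exists q.
have ab : a = b.
  apply/funext => q; have [q0|q0] := leP q 0.
    by rewrite aE cycle0// /emden volterra_le0// subr0.
  by apply: (cycle_eq (bpos q)); rewrite (ltW q0) lexx.
have gpos x : 0 < x -> x <= 1 -> 0 < g x.
  by move=> x0 x1; apply: lt_le_trans (gn _ x0 x1); exact: powR_gt0.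
pose w := g (b 1).
have w0 : 0 < w by apply: gpos => //; exact: Db.2.
have mb := gy_meas Db.
have b1 q := gy_le1 q Db.
have lower Q : 1 <= Q -> w / 8 / Num.sqrt Q <= b Q.
  move=> Q1; have := volterra_increment mb (gy_ge0 b) b1 Q1 (ltW w0).
  move=> /(_ (fun q q1 => g_homo (Db.1 _ _ q1))).
  move/le_trans; apply.
  have := bpos (4 * Q); rewrite [b (4 * Q)]bE [b Q]bE /emden ab; lra.
pose c := w / 8.
have c0 : 0 < c by rewrite /c; lra.
(* With Q = t^2 the lower bound reads c / t <= b on the whole of [0, t^2]. The operator then
   subtracts at least (c / t)^n t^2 / 8, which positivity at t^2 keeps below 1. *)
have upper t : 1 <= t -> (c / t) `^ n * t ^+ 2 < 8.
  move=> t1; have t0 : 0 < t by lra.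
  have Q1 : 1 <= t ^+ 2 by rewrite exprn_ege1.
  have := lower _ Q1; rewrite sqrtr_sqr gtr0_norm// -/c => cb.
  have ct : 0 < c / t by rewrite divr_gt0.
  have := volterra_ge mb (gy_ge0 b) b1 (lt_le_trans ltr01 Q1) (powR_ge0 (c / t) n).
  have h q : q <= t ^+ 2 -> (c / t) `^ n <= (g \o b) q.
    move=> qt; apply: (@le_trans _ _ (b q `^ n)); last exact: gn (bpos q) (Db.2 q).
    have hb : c / t <= b q := le_trans cb (Db.1 _ _ qt).
    by apply: ge0_ler_powR; rewrite ?nnegrE ?(ltW ct) ?(ltW (bpos q)).
  move/(_ h).
  have := bpos (t ^+ 2); rewrite bE /emden ab; lra.
have cn0 : 0 < c `^ n by exact: powR_gt0.
(* The second entry solves c^n t^(2 - n) = 8, so the upper bound fails at the maximum. *)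
pose t := Num.max 1 ((8 / c `^ n) `^ (2 - n)^-1).
have t1 : 1 <= t by rewrite le_max lexx.
have t0 : 0 < t by lra.
have := upper t t1.
have -> : (c / t) `^ n * t ^+ 2 = c `^ n * t `^ (2 - n).
  have -> : t ^+ 2 = t `^ n * t `^ (2 - n).
    rewrite -powRD; last by rewrite (gt_eqF t0) implybT.
    by rewrite subrKC powR_mulrn ?ltW.
  by rewrite mulrA -powRM ?divfK ?gt_eqF ?divr_ge0 ?ltW.
apply/negP; rewrite -leNgt mulrC -ler_pdivrMr//.
have h8 : 0 < 8 / c `^ n by rewrite divr_gt0.
apply: (@le_trans _ _ (((8 / c `^ n) `^ (2 - n)^-1) `^ (2 - n))).
  by rewrite -powRrM mulVf ?powRr1 ?(ltW h8)// subr_eq0 gt_eqF.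
apply: ge0_ler_powR; rewrite ?nnegrE ?powR_ge0 ?(ltW t0)//; first by rewrite subr_ge0 ltW.
by rewrite le_max lexx orbT.
Qed.

End cycle.

(** Q is the first zero. The equation is claimed only up to Q, since beyond it the two members of
    the cycle may separate; there [b] is nonpositive by monotonicity, so [g (b q) = 0] in any
    case. *)
Lemma emden_profile (n : R) : 0 <= n -> n < 2 ->
  (forall x, 0 < x -> x <= 1 -> x `^ n <= g x) -> continuous g ->
  (forall x, x <= 0 -> g x = 0) -> g 1 = 1 ->
  exists (b : R -> R) (Q : R), [/\ 0 < Q, b Q = 0, (forall q, q < Q -> 0 < b q),
    (forall q, q <= Q -> b q = 1 - volterra (g \o b) q) &
    [/\ {homo b : q r / q <= r >-> r <= q}, continuous (g \o b), g (b 0) = 1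
      & forall q, Q <= q -> g (b q) = 0]].
Proof.
move=> n0 n2 gn cg g0 g1.
have [a [b [Da Db ba aE bE]]] := emden_cycle.
have cb := cycle_continuous Da bE.
have [T T0 bT] := cycle_vanishes Da Db ba aE bE n0 n2 gn.
pose Z := [set q | 0 <= q /\ b q <= 0].
have Z0 : has_inf Z.
  by split; [exists T; split => //; exact: ltW|exists 0 => q []].
pose Q := inf Z.
have Qpos q : q < Q -> 0 < b q.
  move=> qQ; have [q0|q0] := leP q 0; first by rewrite (cycle0 bE).
  rewrite ltNge; apply/negP => bq; move: qQ; rewrite ltNge => /negP; apply.
  by apply: ge_inf; [exact: Z0.2|split => //; exact: ltW].
have bQ0 : b Q <= 0.
  rewrite leNgt; apply/negP => bQ.
  have /cvgrPdist_lt/(_ _ bQ)[e /= e0 he] := cb Q.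
  have [r [r0 br] rQ] : exists2 r, Z r & r < Q + e.
    by apply: inf_adherent.
  have Qr : Q <= r by apply: ge_inf; [exact: Z0.2|split].
  have : `|Q - r| < e by rewrite ler0_norm ?subr_le0//; lra.
  by move=> /he; have := ler_norm (b Q - b r); case: r0 => _ ?; lra.
have Q0 : 0 < Q.
  by rewrite ltNge; apply/negP => Q0; move: bQ0; rewrite (cycle0 bE)// ler10.
have bQ : b Q = 0.
  apply/eqP; rewrite eq_le bQ0 /=; rewrite leNgt; apply/negP => bQ.
  have bQ' : 0 < - b Q by rewrite oppr_gt0.
  have /cvgrPdist_lt/(_ _ bQ')[e /= e0 he] := cb Q.
  have : `|Q - (Q - e / 2)| < e by rewrite opprB addrC subrK gtr0_norm; lra.
  have /Qpos h : Q - e / 2 < Q by lra.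
  by move=> /he; have := ler_norm (b (Q - e / 2) - b Q); rewrite distrC; lra.
exists b, Q; split => //.
(* Gronwall gives [a r = b r] only for r < Q, where [b] is positive. This covers q = Q as well
   because the endpoint carries kernel 0. *)
- move=> q qQ; rewrite [LHS]bE /emden; congr (1 - _).
  apply: eq_volterra => r; rewrite in_itv/= => /andP[r0 rq] /=.
  congr g; have /Qpos br : r < Q by exact: lt_le_trans qQ.
  by apply: (cycle_eq Da Db ba aE bE br); rewrite r0 lexx.
- split.
  + exact: Db.1.
  + by move=> q; apply: continuous_comp; [exact: cb|exact: cg].
  + by rewrite (cycle0 bE).
  + by move=> q Qq; rewrite g0// -bQ; exact: Db.1.
Qed.

End lane_emden.

(** * Differentiation of radial functions *)

Section euclidean.
Variable R : realType.
Local Notation E := (R * R * R)%type.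

Definition coord1 : E -> R := fst \o fst.
Definition coord2 : E -> R := snd \o fst.
Definition coord3 : E -> R := snd.
Definition sqn (x : E) : R := x.1.1 ^+ 2 + x.1.2 ^+ 2 + x.2 ^+ 2.

Lemma coord1_linear : linear coord1. Proof. by []. Qed.
Lemma coord2_linear : linear coord2. Proof. by []. Qed.
Lemma coord3_linear : linear coord3. Proof. by []. Qed.
HB.instance Definition _ := GRing.isLinear.Build R E R _ coord1 coord1_linear.
HB.instance Definition _ := GRing.isLinear.Build R E R _ coord2 coord2_linear.
HB.instance Definition _ := GRing.isLinear.Build R E R _ coord3 coord3_linear.

Lemma continuous_coord1 : continuous coord1.
Proof. by move=> x; apply: (@cvg_comp _ _ _ fst fst _ (nbhs x.1)); exact: cvg_fst. Qed.
Lemma continuous_coord2 : continuous coord2.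
Proof. by move=> x; apply: (@cvg_comp _ _ _ fst snd _ (nbhs x.1)); [exact: cvg_fst|exact: cvg_snd]. Qed.
Lemma continuous_coord3 : continuous coord3.
Proof. by move=> x; exact: cvg_snd. Qed.

Lemma is_diff_linear (f : {linear E -> R}) (x : E) : continuous f -> is_diff x f f.
Proof.
by move=> cf; apply: DiffDef; [exact: linear_differentiable|rewrite diff_lin].
Qed.

Lemma is_diff_derive (f df : E -> R) (x v : E) : is_diff x f df -> 'D_v f x = df v.
Proof. by move=> h; rewrite deriveE// diff_val. Qed.

Lemma is_diff_sqn (x : E) : is_diff x sqn
  (fun h => 2 * (coord1 x * coord1 h + coord2 x * coord2 h + coord3 x * coord3 h)).
Proof.
have d1 := is_diff_linear x continuous_coord1.
have d2 := is_diff_linear x continuous_coord2.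
have d3 := is_diff_linear x continuous_coord3.
have h := is_diffD (is_diffD (is_diffM d1 d1) (is_diffM d2 d2)) (is_diffM d3 d3).
have h' : is_diff x sqn _ := h.
apply: (is_diff_eq h'); apply/funext => v.
rewrite !fctE /GRing.scale /=; ring.
Qed.

Lemma is_diff_radial (phi : R -> R) (d : R) (x : E) : is_derive (sqn x) 1 phi d ->
  is_diff x (phi \o sqn)
    (fun h => 2 * d * (coord1 x * coord1 h + coord2 x * coord2 h + coord3 x * coord3 h)).
Proof.
move=> hd.
have dphi : is_diff (sqn x) phi (fun t => t * d).
  have ex : derivable phi (sqn x) 1 by [].
  apply: DiffDef; first exact/derivable1_diffP.
  by rewrite deriv1E// derive1E derive_val.
have := is_diff_comp (is_diff_sqn x) dphi.
by move/is_diff_eq; apply; apply/funext => v /=; ring.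
Qed.

(** The remainder l x (h x - h 0) is o(|x|) as soon as h is continuous at 0, for l is O(|x|). This
    yields derivatives at the origin without differentiating radial factors there. *)
Lemma is_diff_mul_vanishing (l : {linear E -> R}) (h : E -> R) :
  continuous l -> {for 0, continuous h} ->
  is_diff (0 : E) (fun x => l x * h x) (fun v => h 0 * l v).
Proof.
move=> cl ch.
have [k k0 lk] := linear_lipschitz cl.
have cdf : continuous (h 0 \*: l).
  by move=> x; apply: cvgM; [exact: cvg_cst|exact: cl].
have H : (fun x => l x * h x) \o shift 0 = cst (l 0 * h 0) + (h 0 \*: l) +o_ (0 : E) id.
  apply/eqaddoP => e e0; near=> x.
  rewrite !fctE /= addr0 linear0 mul0r add0r.
  have -> : l x * h x - h 0 * l x = l x * (h x - h 0) by ring.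
  rewrite normrM; apply: (@le_trans _ _ ((k * `|x|) * (e / k))).
    apply: ler_pM => //; rewrite distrC; near: x.
    by apply: (@cvgr_dist_le _ _ _ _ _ h (h 0)) => //; rewrite divr_gt0.
  have -> : k * `|x| * (e / k) = e * `|x| by field; rewrite gt_eqF.
  by [].
have dE : 'd (fun x => l x * h x) (0 : E) = (h 0 \*: l) :> (E -> R).
  exact: (diff_unique cdf H).
apply: DiffDef; last by rewrite dE.
by apply/diff_locallyP; rewrite dE.
Unshelve. all: by end_near. Qed.

End euclidean.

(** * Poisson's equation for a radial density *)

Section radial_potential.
Variable R : realType.
Local Notation mu := (@lebesgue_measure R).
Local Notation M := (measurableTypeR R).
Local Notation E := (R * R * R)%type.
Variable G : R -> R.
Hypotheses (cG : continuous G) (G0 : forall q, 0 <= G q) (G1 : forall q, G q <= 1)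
  (dG : {homo G : q r / q <= r >-> r <= q}).

Let mG : measurable_fun [set: R] G. Proof. exact: continuous_measurable_fun. Qed.

(** Up to the factor 2 pi, the mass of the density G (|x|^2) in the ball |x|^2 <= Q. *)
Definition mass (Q : R) : R := \int[mu]_(q in `[0, Q]) (Num.sqrt q * G q).

Let csG : continuous (fun q : R => Num.sqrt q * G q).
Proof. by move=> q; apply: cvgM; [exact: sqrt_continuous|exact: cG]. Qed.

Let int_cont (f : R -> R) (a b : R) : continuous f -> mu.-integrable `[a, b] (EFin \o f).
Proof.
move=> cf; apply: continuous_compact_integrable; first exact: segment_compact.
exact: continuous_subspaceT.
Qed.

Lemma is_derive_integral (f : R -> R) (Q : R) : continuous f -> 0 < Q ->
  is_derive Q 1 (fun Q => \int[mu]_(q in `[0, Q]) f q) (f Q).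
Proof.
move=> cf Q0.
(* The interval is extended to Q + 1 so that Q is an interior point. *)
have [|d e] := @continuous_FTC1_closed R f 0 Q (Q + 1) _ (int_cont _ _ cf) Q0 (cf Q).
  by rewrite ltrDl.
by apply: DeriveDef; [exact: d|rewrite -derive1E; exact: e].
Qed.

(** Moving Q out of the integrand leaves two integrals with variable endpoint, to which the
    fundamental theorem applies. *)
Lemma volterraE Q : volterra G Q = \int[mu]_(q in `[0, Q]) G q - (Num.sqrt Q)^-1 * mass Q.
Proof.
rewrite /mass -RintegralZl//; last exact: int_cont.
rewrite -RintegralB//; first last.
- by apply: int_cont => q; apply: cvgM; [exact: cvg_cst|exact: csG].
- exact: int_cont.
by apply: eq_Rintegral => q _; rewrite /volterra_kernel; ring.
Qed.

Lemma is_derive_sqrtV (Q : R) : 0 < Q ->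
  is_derive Q 1 (fun Q : R => (Num.sqrt Q)^-1) (- (2 * (Q * Num.sqrt Q))^-1).
Proof.
move=> Q0; have sQ : 0 < Num.sqrt Q by rewrite sqrtr_gt0.
have d := is_derive1_sqrt Q0.
have sn : Num.sqrt Q != 0 by rewrite gt_eqF.
have s2 : Num.sqrt Q ^+ 2 = Q by rewrite sqr_sqrtr// ltW.
apply: (is_derive_eq (is_deriveV sn d)); rewrite /GRing.scale /=.
by rewrite s2; field; rewrite sn gt_eqF.
Qed.

(** The derivative of the potential in Q = r^2, that is Newton's mass / r^2 divided by dQ/dr = 2
    r. *)
Definition field_strength (Q : R) : R := mass Q / (2 * (Q * Num.sqrt Q)).

Lemma is_derive_volterra (Q : R) : 0 < Q -> is_derive Q 1 (volterra G) (field_strength Q).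
Proof.
move=> Q0; have sQ : 0 < Num.sqrt Q by rewrite sqrtr_gt0.
have dN := is_derive_integral cG Q0.
have dM : is_derive Q 1 mass (Num.sqrt Q * G Q) := is_derive_integral csG Q0.
have -> : volterra G = (fun Q => \int[mu]_(q in `[0, Q]) G q) - (fun Q : R => (Num.sqrt Q)^-1) * mass.
  by apply/funext => q; rewrite volterraE.
have h := is_deriveB dN (is_deriveM (is_derive_sqrtV Q0) dM).
apply: (is_derive_eq h); rewrite /field_strength /GRing.scale /=.
by field; rewrite !gt_eqF.
Qed.

(** This is the radial Poisson equation 4 Q h' + 6 h = 2 G for the field strength h. *)
Lemma is_derive_field_strength (Q : R) : 0 < Q ->
  is_derive Q 1 field_strength (G Q / (2 * Q) - 3 / 2 * field_strength Q / Q).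
Proof.
move=> Q0; have sQ : 0 < Num.sqrt Q by rewrite sqrtr_gt0.
have s2 : Num.sqrt Q ^+ 2 = Q by rewrite sqr_sqrtr// ltW.
have dM : is_derive Q 1 mass (Num.sqrt Q * G Q) := is_derive_integral csG Q0.
have dV : is_derive Q 1 (fun Q : R => Q^-1) (- Q ^- 2).
  have Qn : Q != 0 by rewrite gt_eqF.
  by apply: (is_derive_eq (is_deriveV (f := id) Qn (is_derive_id Q 1))); rewrite /GRing.scale /= mulr1.
have h := is_deriveZ 2^-1 (is_deriveM dM (is_deriveM dV (is_derive_sqrtV Q0))).
have -> : field_strength = 2^-1 *: (mass * ((fun Q : R => Q^-1) * (fun Q : R => (Num.sqrt Q)^-1))).
  by apply/funext => q; rewrite /field_strength !fctE /= !invfM /GRing.scale /=; ring.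
apply: (is_derive_eq h); rewrite /field_strength /GRing.scale /=.
rewrite !fctE /GRing.scale /=.
set s := Num.sqrt Q in sQ s2 *; rewrite -s2.
by field; rewrite !gt_eqF.
Qed.

Lemma integral_sqrt Q : 0 < Q -> \int[mu]_(q in `[0, Q]) Num.sqrt q = 2 / 3 * (Q * Num.sqrt Q).
Proof.
move=> Q0; pose F (q : R) := 2 / 3 * (q * Num.sqrt q).
have cF : continuous F.
  move=> q; apply: cvgM; first exact: cvg_cst.
  by apply: cvgM; [exact: cvg_id|exact: sqrt_continuous].
have dF (q : R) : 0 < q -> is_derive q 1 F (Num.sqrt q).
  move=> q0; have sq : 0 < Num.sqrt q by rewrite sqrtr_gt0.
  have h := is_deriveZ (2 / 3) (is_deriveM (is_derive_id q 1) (is_derive1_sqrt q0)).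
  have s2 : Num.sqrt q ^+ 2 = q by rewrite sqr_sqrtr// ltW.
  apply: (is_derive_eq h); rewrite /GRing.scale /=.
  set s := Num.sqrt q in sq s2 *; rewrite -s2.
  by field; rewrite gt_eqF.
rewrite /Rintegral (@continuous_FTC2 R _ F)//=.
- by rewrite /F mul0r mulr0 subr0.
- by apply: continuous_subspaceT => q; exact: sqrt_continuous.
- split.
  + by move=> q /[!in_itv]/= /andP[q0 _]; have := dF _ q0 => ?; exact: ex_derive.
  + by apply: cvg_at_right_filter; exact: cF.
  + by apply: cvg_at_left_filter; exact: cF.
- by move=> q /[!in_itv]/= /andP[q0 _]; have := dF _ q0 => ?; rewrite derive1E derive_val.
Qed.

(** Three times the field strength is the mean of G on [0, Q] with weight sqrt q, and G is
    non-increasing. The squeeze gives the limit G 0 / 3 at the origin, and the lower bound gives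
    positivity of the mass. *)
Lemma field_strength_bounds Q : 0 < Q -> G Q / 3 <= field_strength Q <= G 0 / 3.
Proof.
move=> Q0; have sQ : 0 < Num.sqrt Q by rewrite sqrtr_gt0.
have p : 0 < 2 * (Q * Num.sqrt Q) by rewrite !mulr_gt0.
have cs : continuous (@Num.sqrt R) by exact: sqrt_continuous.
have H (t : R) : t / 3 * (2 * (Q * Num.sqrt Q)) = \int[mu]_(q in `[0, Q]) (t * Num.sqrt q).
  rewrite RintegralZl//; last exact: int_cont.
  by rewrite integral_sqrt//; field.
have it (t : R) : mu.-integrable `[0, Q] (EFin \o (fun q => t * Num.sqrt q)).
  by apply: int_cont => q; apply: cvgM; [exact: cvg_cst|exact: cs].
rewrite /field_strength ler_pdivlMr// ler_pdivrMr// !H /mass; apply/andP; split.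
  apply: le_Rintegral => //; first exact: int_cont.
  move=> q /= /[!in_itv]/= /andP[q0 qQ].
  by rewrite mulrC ler_wpM2l ?sqrtr_ge0// dG.
apply: le_Rintegral => //; first exact: int_cont.
move=> q /= /[!in_itv]/= /andP[q0 qQ].
by rewrite mulrC ler_wpM2r ?sqrtr_ge0// dG.
Qed.

Lemma sqn_ge0 (x : E) : 0 <= sqn x. Proof. by rewrite !addr_ge0// sqr_ge0. Qed.

Lemma sqn_eq0 (x : E) : (sqn x == 0) = (x == 0).
Proof.
case: x => [[a b] c]; rewrite /sqn /= paddr_eq0 ?addr_ge0 ?sqr_ge0// paddr_eq0 ?sqr_ge0//.
by rewrite !sqrf_eq0.
Qed.

Lemma sqn_gt0 (x : E) : x != 0 -> 0 < sqn x.
Proof. by move=> x0; rewrite lt_neqAle eq_sym sqn_eq0 x0 sqn_ge0. Qed.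

Lemma continuous_sqn : continuous (@sqn R).
Proof.
move=> x; apply: differentiable_continuous.
by have [] := is_diff_sqn x.
Qed.

Lemma sqn0 : sqn (0 : E) = 0.
Proof. by rewrite /sqn /= expr0n/= !addr0. Qed.

(** At the origin [field_strength 0] is 0 by the convention on division, so the true limit has to be
    put in by hand. *)
Definition field_strength_ext (x : E) : R :=
  if x == 0 then G 0 / 3 else field_strength (sqn x).

Lemma continuous_field_strength_ext : {for 0, continuous field_strength_ext}.
Proof.
have cGs : {for 0, continuous (fun x : E => (G 0 - G (sqn x)) / 3)}.
  apply: cvgM; last exact: cvg_cst.
  apply: cvgB; first exact: cvg_cst.
  by apply: continuous_comp; [exact: continuous_sqn|exact: cG].
apply/cvgrPdist_le => e e0.
have := cGs; move/cvgrPdist_le/(_ e e0); apply: filterS => x.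
rewrite sqn0 subrr mul0r sub0r normrN /field_strength_ext eqxx.
have p : 0 <= (G 0 - G (sqn x)) / 3 by rewrite divr_ge0// subr_ge0 dG// sqn_ge0.
rewrite (ger0_norm p); case: eqVneq => [_|x0]; first by rewrite subrr normr0; exact: le_trans.
have /andP[h1 h2] := field_strength_bounds (sqn_gt0 x0).
by rewrite ger0_norm ?subr_ge0//; lra.
Qed.

Variables (c0 c : R).
Definition radial_field (x : E) : R := c0 + c * volterra G (sqn x).

Lemma is_diff_radial_field (x : E) : is_diff x radial_field
  (fun h => 2 * c * field_strength (sqn x) *
     (coord1 x * coord1 h + coord2 x * coord2 h + coord3 x * coord3 h)).
Proof.
suff h : is_diff x (volterra G \o @sqn R) (fun h => 2 * field_strength (sqn x) *
     (coord1 x * coord1 h + coord2 x * coord2 h + coord3 x * coord3 h)).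
  have h' := is_diffD (is_diff_cst c0 x) (is_diffZ c h).
  have h'' : is_diff x radial_field _ := h'.
  apply: (is_diff_eq h''); apply/funext => v.
  transitivity (0 + c * (2 * field_strength (sqn x) *
    (coord1 x * coord1 v + coord2 x * coord2 v + coord3 x * coord3 v))); first by [].
  by ring.
have [->|x0] := eqVneq x 0; last first.
  exact: is_diff_radial (is_derive_volterra (sqn_gt0 x0)).
(* At the origin the potential is written as the sum of [coord_i x * (coord_i x * k x)]. The
   quotient [k] is bounded by 1, so each second factor tends to 0 and is continuous at the
   origin. *)
pose k (x : E) := volterra G (sqn x) / sqn x.
have ck (l : {linear E -> R}) : continuous l -> {for 0, continuous (fun x => l x * k x)}.
  move=> cl; have l0 : l 0 = 0 := linear0 l.
  apply/cvgrPdist_le => e e0; have /cvgrPdist_le/(_ e e0) := cl 0.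
  apply: filterS => y; rewrite l0 mul0r !sub0r !normrN normrM => /(le_trans _); apply.
  rewrite ler_piMr// /k; have [->|y0] := eqVneq y 0; first by rewrite sqn0 invr0 mulr0 normr0.
  have sy := sqn_gt0 y0.
  rewrite ger0_norm ?divr_ge0 ?(ltW sy) ?volterra_ge0//.
  by rewrite ler_pdivrMr//; apply: (volterra_le mG G0 G1); exact: ltW.
have d1 := is_diff_mul_vanishing (@continuous_coord1 R) (ck _ (@continuous_coord1 R)).
have d2 := is_diff_mul_vanishing (@continuous_coord2 R) (ck _ (@continuous_coord2 R)).
have d3 := is_diff_mul_vanishing (@continuous_coord3 R) (ck _ (@continuous_coord3 R)).
have h := is_diffD (is_diffD d1 d2) d3.
have -> : volterra G \o @sqn R = (fun x => coord1 x * (coord1 x * k x)) + (fun x => coord2 x * (coord2 x * k x)) + (fun x => coord3 x * (coord3 x * k x)).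
  apply/funext => y; rewrite !fctE /=.
  have [->|y0] := eqVneq y 0.
    by rewrite !linear0 sqn0 volterra_le0// !mul0r !addr0.
  have sy := sqn_gt0 y0.
  have -> : coord1 y * (coord1 y * k y) + coord2 y * (coord2 y * k y) + coord3 y * (coord3 y * k y) = k y * sqn y.
    by rewrite /sqn /coord1 /coord2 /coord3 /=; ring.
  by rewrite /k divfK// gt_eqF.
apply: (is_diff_eq h); apply/funext => v; rewrite !fctE /= !linear0; ring.
Qed.

Lemma derive_radial_field (x v : E) : 'D_v radial_field x =
  2 * c * field_strength (sqn x) *
     (coord1 x * coord1 v + coord2 x * coord2 v + coord3 x * coord3 v).
Proof. exact: (is_diff_derive v (is_diff_radial_field x)). Qed.

(** Away from the origin this is the product rule. At the origin the linear factor vanishes, so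
    continuity of the extended field strength is enough. *)
Lemma is_diff_field_component (l : {linear E -> R}) (x : E) : continuous l ->
  is_diff x (fun x => 2 * c * field_strength (sqn x) * l x)
   (fun h => if x == 0 then 2 * c * (G 0 / 3) * l h else
      2 * c * (field_strength (sqn x) * l h +
        (G (sqn x) - 3 * field_strength (sqn x)) / sqn x * l x *
        (coord1 x * coord1 h + coord2 x * coord2 h + coord3 x * coord3 h))).
Proof.
move=> cl; have [->|x0] := eqVneq x 0.
  have h := is_diffZ (2 * c) (is_diff_mul_vanishing cl continuous_field_strength_ext).
  have -> : (fun x => 2 * c * field_strength (sqn x) * l x) = (2 * c) *: (fun x => l x * field_strength_ext x).
    apply/funext => y; rewrite !fctE /GRing.scale /= /field_strength_ext.
    by case: eqVneq => [->|y0]; [rewrite linear0 !(mulr0, mul0r)|ring].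
  apply: (is_diff_eq h); apply/funext => v.
  by rewrite !fctE /GRing.scale /= /field_strength_ext eqxx; ring.
have h := is_diffZ (2 * c) (is_diffM (is_diff_radial (is_derive_field_strength (sqn_gt0 x0))) (is_diff_linear x cl)).
have -> : (fun x => 2 * c * field_strength (sqn x) * l x) = (2 * c) *: ((field_strength \o @sqn R) * l).
  by apply/funext => y; rewrite !fctE /GRing.scale /=; ring.
apply: (is_diff_eq h); apply/funext => v; rewrite !fctE /GRing.scale /=.
by field; rewrite gt_eqF// sqn_gt0.
Qed.

Lemma is_diff_partial (l : {linear E -> R}) (e x : E) : continuous l ->
  (forall y, coord1 y * coord1 e + coord2 y * coord2 e + coord3 y * coord3 e = l y) ->
  is_diff x ('D_e radial_field)
   (fun h => if x == 0 then 2 * c * (G 0 / 3) * l h else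
      2 * c * (field_strength (sqn x) * l h +
        (G (sqn x) - 3 * field_strength (sqn x)) / sqn x * l x *
        (coord1 x * coord1 h + coord2 x * coord2 h + coord3 x * coord3 h))).
Proof.
move=> cl le.
have -> : 'D_e radial_field = fun x => 2 * c * field_strength (sqn x) * l x.
  by apply/funext => y; rewrite derive_radial_field le.
exact: is_diff_field_component.
Qed.

Let is_diff_partial1 (x : E) := @is_diff_partial _ (e1 R) x (@continuous_coord1 R)
  (fun y => ltac:(by rewrite /coord1 /coord2 /coord3 /=; ring)).
Let is_diff_partial2 (x : E) := @is_diff_partial _ (e2 R) x (@continuous_coord2 R)
  (fun y => ltac:(by rewrite /coord1 /coord2 /coord3 /=; ring)).
Let is_diff_partial3 (x : E) := @is_diff_partial _ (e3 R) x (@continuous_coord3 R)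
  (fun y => ltac:(by rewrite /coord1 /coord2 /coord3 /=; ring)).

Lemma twice_differentiable_radial_field : twice_differentiable radial_field.
Proof.
move=> x; split; first by have [] := is_diff_radial_field x.
split.
- by have [] := is_diff_partial1 x.
- by have [] := is_diff_partial2 x.
- by have [] := is_diff_partial3 x.
Qed.

Lemma derive2_radial_field (l : {linear E -> R}) (e x : E) : continuous l -> l e = 1 ->
  (forall y, coord1 y * coord1 e + coord2 y * coord2 e + coord3 y * coord3 e = l y) ->
  'D_e ('D_e radial_field) x = if x == 0 then 2 * c * (G 0 / 3) else
    2 * c * (field_strength (sqn x) +
      (G (sqn x) - 3 * field_strength (sqn x)) / sqn x * l x ^+ 2).
Proof.
move=> cl l1 le; apply: (etrans (is_diff_derive e (is_diff_partial x cl le))).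
by rewrite le l1 /=; case: ifP => _; ring.
Qed.

(** Off the origin the squared coordinates add up to |x|^2 and the field strengths cancel; at the
    origin three terms G 0 / 3 add up. *)
Lemma laplacian_radial_field (x : E) : laplacian radial_field x = 2 * c * G (sqn x).
Proof.
pose B (y : R) := if x == 0 then 2 * c * (G 0 / 3) else
    2 * c * (field_strength (sqn x) + (G (sqn x) - 3 * field_strength (sqn x)) / sqn x * y ^+ 2).
have L1 : 'D_(e1 R) ('D_(e1 R) radial_field) x = B x.1.1.
  have h (y : E) : coord1 y * coord1 (e1 R) + coord2 y * coord2 (e1 R) + coord3 y * coord3 (e1 R) = coord1 y.
    by rewrite /coord1 /coord2 /coord3 /=; ring.
  exact (derive2_radial_field (l := @coord1 R) (e := e1 R) x (@continuous_coord1 R) erefl h).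
have L2 : 'D_(e2 R) ('D_(e2 R) radial_field) x = B x.1.2.
  have h (y : E) : coord1 y * coord1 (e2 R) + coord2 y * coord2 (e2 R) + coord3 y * coord3 (e2 R) = coord2 y.
    by rewrite /coord1 /coord2 /coord3 /=; ring.
  exact (derive2_radial_field (l := @coord2 R) (e := e2 R) x (@continuous_coord2 R) erefl h).
have L3 : 'D_(e3 R) ('D_(e3 R) radial_field) x = B x.2.
  have h (y : E) : coord1 y * coord1 (e3 R) + coord2 y * coord2 (e3 R) + coord3 y * coord3 (e3 R) = coord3 y.
    by rewrite /coord1 /coord2 /coord3 /=; ring.
  exact (derive2_radial_field (l := @coord3 R) (e := e3 R) x (@continuous_coord3 R) erefl h).
have sE : sqn x = x.1.1 ^+ 2 + x.1.2 ^+ 2 + x.2 ^+ 2 by [].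
apply: (etrans (congr2 +%R (congr2 +%R L1 L2) L3)); rewrite /B.
case: eqVneq => [->|x0]; first by rewrite sqn0; field.
(* Generalising the coordinates, the field strength and the density leaves a purely algebraic
   identity. *)
move: (sqn_gt0 x0) sE; set h := field_strength _; set g := G _.
move: (x.1.1) (x.1.2) (x.2) (sqn x) h g => y1 y2 y3 s h g s0 sE.
have -> : 2 * c * g = 2 * c * (3 * h + (g - 3 * h) / s * s) by field; rewrite gt_eqF.
by move: (_ / s) => d; rewrite sE; ring.
Qed.

End radial_potential.

(** * The truncated power *)

Section power_profile.
Variables (R : realType) (n : R).
Hypotheses (n0 : 0 < n).

Lemma pos_pow_homo : {homo (fun x : R => pos_pow x n) : x y / x <= y}.
Proof.
move=> x y xy; rewrite /pos_pow; case: ifPn => x0; last first.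
  by case: ifP => // _; exact: powR_ge0.
have y0 : 0 < y by exact: lt_le_trans xy.
by rewrite y0 ge0_ler_powR// ?nnegrE ?ltW.
Qed.

Lemma pos_pow1 : pos_pow (1 : R) n = 1.
Proof. by rewrite /pos_pow ltr01 powR1. Qed.

Lemma pos_pow_le1 (x : R) : x <= 1 -> pos_pow x n <= 1.
Proof. by move=> x1; rewrite -[leRHS]pos_pow1; exact: pos_pow_homo. Qed.

Lemma pos_pow_le0 (x : R) : x <= 0 -> pos_pow x n = 0.
Proof. by rewrite leNgt /pos_pow => /negbTE ->. Qed.

Lemma continuous_pos_pow : continuous (fun x : R => pos_pow x n).
Proof.
move=> x; have [x0|x0|->] := ltgtP x 0.
- rewrite /continuous_at pos_pow_le0 ?ltW//; apply: cvg_near_cst; near=> y.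
  by rewrite pos_pow_le0// ltW//; near: y; exact: lt_nbhsl.
- rewrite /continuous_at [pos_pow x n]ifT//.
  apply: (@cvg_trans _ ((@powR R ^~ n) @ x)); last exact: continuous_powR.
  apply: near_eq_cvg; near=> y; rewrite /pos_pow ifT//.
  by near: y; exact: lt_nbhsr.
- rewrite /continuous_at pos_pow_le0//; apply/cvgrPdist_le => e e0.
  (* For n < 1 the power is not Lipschitz at 0; the radius e^(1/n) inverts it directly. *)
  exists (e `^ n^-1) => /=; first exact: powR_gt0.
  move=> y; rewrite /= !sub0r !normrN => ye.
  rewrite ger0_norm ?pos_pow_ge0// /pos_pow; case: ifPn => y0; last exact: ltW.
  rewrite -[e](powRr1 (ltW e0)) -(mulVf (lt0r_neq0 n0)) powRrM.
  by rewrite ge0_ler_powR// ?nnegrE ?powR_ge0 ?(ltW n0) ?(ltW y0)// (le_trans (ler_norm y))// ltW.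
Unshelve. all: by end_near. Qed.

Lemma pos_pow_lipschitz (e : R) : 0 < e -> exists2 L, 0 < L &
  forall x y, e <= x -> x <= y -> y <= 1 -> pos_pow y n - pos_pow x n <= L * (y - x).
Proof.
move=> e0; exists (n / e); first exact: divr_gt0.
move=> x y ex xy y1.
have x0 : 0 < x by exact: lt_le_trans ex.
have y0 : 0 < y by exact: lt_le_trans xy.
rewrite /pos_pow x0 y0; have [->|nxy] := eqVneq x y; first by rewrite !subrr mulr0.
have xlty : x < y by rewrite lt_neqAle nxy.
have [z zI ->] : exists2 z, z \in `]x, y[ & y `^ n - x `^ n = n * z `^ (n - 1) * (y - x).
  apply: (@MVT R (@powR R ^~ n)) => //.
    by move=> z /[!in_itv]/= /andP[xz _]; apply: is_derive_powR; exact: lt_trans xz.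
  apply: continuous_in_subspaceT => z; rewrite inE/= in_itv/= => /andP[xz _].
  by apply: continuous_powR; exact: lt_le_trans xz.
move: zI; rewrite in_itv/= => /andP[xz zy].
have z0 : 0 < z by exact: lt_trans xz.
rewrite ler_wpM2r ?subr_ge0// ler_wpM2l ?(ltW n0)//.
(* Splitting z^(n - 1) into z^n <= 1 and 1 / z <= 1 / e treats n below and above 1 alike. *)
rewrite powRD; last by rewrite (gt_eqF z0) implybT.
rewrite powR_inv1 ?(ltW z0)// -[leRHS]mul1r ler_pM ?powR_ge0 ?invr_ge0 ?(ltW z0)//.
  have -> : 1 = 1 `^ n :> R by rewrite powR1.
  by rewrite ge0_ler_powR ?nnegrE ?(ltW n0) ?(ltW z0)// ltW// (lt_le_trans zy).
by rewrite lef_pV2 ?posrE// (le_trans ex)// ltW.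
Qed.

End power_profile.

(** * Scaling, and the potential through the radial Poisson operator *)

Section scaling.
Variable R : realType.
Local Notation mu := (@lebesgue_measure R).
Local Notation M := (measurableTypeR R).

(** The kernel depends only on q / Q, so dilating q contributes just the factor s of dq. *)
Lemma volterra_scale (F : R -> R) (c s Q : R) : measurable_fun [set: R] F ->
  (forall q, 0 <= F q) -> (forall q, F q <= c) -> 0 < s ->
  volterra F (s * Q) = s * volterra (fun q => F (s * q)) Q.
Proof.
move=> mF F0 Fc s0; rewrite /volterra /Rintegral.
have h : measurable_fun [set: R] ((fun q => (volterra_kernel (s * Q) q * F q)%:E) \_ `[0, s * Q]).
  apply: (measurable_restrictT _ _).1 => //; apply: measurable_funTS.
  by apply/measurable_EFinP; exact: measurable_volterra_integrand.
rewrite [in LHS]integral_mkcond -(@ge0_integral_affine R s 0)//; last first.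
  move=> q; rewrite patchE mem_setE in_itv/=; case: ifPn => // /andP[q0 qQ].
  by rewrite lee_fin mulr_ge0// volterra_kernel_ge0.
have -> : (\int[mu]_x ((fun q => (volterra_kernel (s * Q) q * F q)%:E) \_ `[0%R, (s * Q)%R]) (s * x + 0)%R
    = \int[mu]_(q in `[0%R, Q]) (volterra_kernel Q q * F (s * q))%:E)%E.
  rewrite [RHS]integral_mkcond; apply: eq_integral => q _.
  rewrite !patchE !mem_setE !in_itv/= addr0 pmulr_rge0// ler_pM2l//.
  case: ifPn => // /andP[q0 qQ]; congr EFin; congr (_ * _).
  rewrite /volterra_kernel !sqrtrM ?(ltW s0)//.
  have [Q0|Q0] := ltP 0 Q; last by rewrite (ler0_sqrtr Q0) !(mulr0, invr0).
  by field; rewrite !gt_eqF// sqrtr_gt0.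
rewrite fineM//; apply: integrable_fin_num => //.
have mFs : measurable_fun [set: R] (fun q => F (s * q)).
  by apply: (measurableT_comp mF); exact: measurable_funM.
exact: (integrable_volterra mFs _ (fun q => Fc (s * q))).
Qed.

(** The shell weight min (sqrt q, r) / r is 1 minus the kernel inside the sphere of radius r and 1
    outside, so the potential is its central value corrected by the operator. *)
Lemma newton_integral_volterra (F : R -> R) (x : R * R * R) :
  continuous F -> (forall q, 0 <= F q) -> (forall q, F q <= 1) -> (forall q, 1 <= q -> F q = 0) ->
  newton_integral F x = (2 * pi * (\int[mu]_(q in `[0, 1]) F q - volterra F (sqn x)))%:E.
Proof.
move=> cF F0 F1 Fz.
have mF : measurable_fun [set: R] F by exact: continuous_measurable_fun.
rewrite newton_integralE// [RHS]EFinM; congr (_ * _)%E.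
pose Q := sqn x; have Q0 : 0 <= Q := sqn_ge0 x.
have -> : enorm x = Num.sqrt Q by [].
(* The kernel extended by 0 to q > Q and to the centre, where the shell weight is 1. *)
pose k (q : R) := if (0 < Q) && (q <= Q) then volterra_kernel Q q else 0.
have wk (q : R) : 0 <= q ->
    (if Num.sqrt Q == 0 then 1 else Num.min (Num.sqrt q) (Num.sqrt Q) / Num.sqrt Q) = 1 - k q.
  move=> q0; rewrite /k sqrtr_eq0.
  have [Qn|Qp] := leP Q 0; first by rewrite subr0.
  have sQ : Num.sqrt Q != 0 by rewrite gt_eqF// sqrtr_gt0.
  have [qQ|qQ] /= := leP q Q.
    by rewrite min_l ?ler_sqrt ?(ltW Qp)// /volterra_kernel opprB addrC subrK mulrC.
  by rewrite min_r ?subr0 ?divff// ler_sqrt ?ltW// (le_lt_trans Q0).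
have k01 q : 0 <= k q <= 1.
  rewrite /k; case: ifPn => [/andP[_ qQ]|_]; last by rewrite lexx ler01.
  by rewrite volterra_kernel_ge0// volterra_kernel_le1.
have mk : measurable_fun [set: R] k.
  rewrite /k; apply: measurable_fun_if => //.
  - by apply: measurable_and => //; exact: measurable_fun_ler.
  - apply: measurable_funTS; apply: measurable_funB => //; apply: measurable_funM => //.
    by apply: continuous_measurable_fun; exact: sqrt_continuous.
have int_kF : mu.-integrable `[0, 1] (EFin \o (fun q => k q * F q)).
  apply: (@bounded_itv_integrable _ _ _ _ 1); first exact: measurable_funM.
  move=> q; have /andP[k0 k1] := k01 q.
  by rewrite ger0_norm ?mulr_ge0// -[leRHS]mulr1 ler_pM.
have int_F : mu.-integrable `[0, 1] (EFin \o F).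
  by apply: (@bounded_itv_integrable _ _ _ _ 1) => // q; rewrite ger0_norm.
transitivity (\int[mu]_(q in `[0%R, 1%R]) (F q - k q * F q)%:E)%E.
  rewrite [LHS]integral_mkcond [RHS]integral_mkcond; apply: eq_integral => q _.
  rewrite !patchE !mem_setE !in_itv/= andbT; have [q0|//] := leP 0 q.
  rewrite wk//; have [q1|q1] := leP q 1; first by congr EFin; ring.
  by rewrite Fz ?mul0r// ltW.
transitivity (\int[mu]_(q in `[0, 1]) (F q - k q * F q))%:E.
  rewrite /Rintegral fineK//; apply: integrable_fin_num => //.
  exact: (integrableB _ int_F int_kF).
rewrite RintegralB//; congr (_ - _)%:E.
have [Qn|Qp] := leP Q 0.
  by rewrite volterra_le0// /Rintegral integral0_eq// => q _; rewrite /k ltNge Qn mul0r.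
rewrite /volterra -/Q /Rintegral [in LHS]integral_mkcond [in RHS]integral_mkcond; congr fine.
apply: eq_integral => q _.
rewrite !patchE !mem_setE !in_itv/= /k Qp /=; have [q0|//] := leP 0 q.
have [q1|q1] /= := leP q 1; first by case: ifP => _; rewrite ?mul0r.
by rewrite Fz ?mulr0 ?if_same// ltW.
Qed.

End scaling.

(** With b the profile and s its first zero, G q is the power of b (s q). Dilation puts the factor s
    in front of the operator, and b s = 0 becomes [s * volterra G 1 = 1]. *)
Lemma lane_emden_density (R : realType) (n : R) : 0 < n -> n < 2 ->
  exists (G : R -> R) (s : R),
    [/\ 0 < s, continuous G, (forall q, 0 <= G q <= 1),
        {homo G : q r / q <= r >-> r <= q} &
        [/\ (forall q, 1 <= q -> G q = 0), G 0 = 1, s * volterra G 1 = 1 &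
            forall q, q <= 1 -> G q = pos_pow (1 - s * volterra G q) n]].
Proof.
move=> n0 n2.
have [||||b [s [s0 bs bpos bE [db cgb gb0 gbz]]]] :=
    @emden_profile R (fun x => pos_pow x n) (pos_pow_homo n0) (fun x => pos_pow_ge0 x n)
      (pos_pow_le1 n0) (pos_pow_lipschitz n0) n (ltW n0) n2.
- by move=> x x0 _; rewrite /pos_pow x0.
- exact: continuous_pos_pow.
- by move=> x; exact: pos_pow_le0.
- exact: pos_pow1.
set g := fun x : R => pos_pow x n in cgb gb0 gbz bE.
have b1 q : b q <= 1.
  have [q0|q0] := leP q 0; first by rewrite bE ?volterra_le0 ?subr0// (le_trans q0)// ltW.
  by rewrite (le_trans (db _ _ (ltW q0)))// bE ?volterra_le0 ?subr0// ltW.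
have E q : q <= 1 -> b (s * q) = 1 - s * volterra (fun q => g (b (s * q))) q.
  move=> q1; rewrite bE; last by rewrite -[leRHS]mulr1 ler_wpM2l// ltW.
  rewrite (@volterra_scale R (g \o b) 1)//.
  - exact: continuous_measurable_fun.
  - by move=> r; exact: pos_pow_ge0.
  - by move=> r; exact: pos_pow_le1.
exists (fun q => g (b (s * q))), s; split => //.
- move=> q; apply: (@continuous_comp _ _ _ (fun q => s * q) (g \o b)); last exact: cgb.
  by apply: cvgM; [exact: cvg_cst|exact: cvg_id].
- by move=> q; rewrite pos_pow_ge0 pos_pow_le1.
- by move=> q r qr; apply: pos_pow_homo => //; apply: db; rewrite ler_pM2l.
- split.
  + by move=> q q1; apply: gbz; rewrite -[leLHS]mulr1 ler_pM2l.
  + by rewrite mulr0.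
  + by apply/eqP; rewrite eq_sym -subr_eq0 -E// mulr1 bs.
  + by move=> q q1; rewrite -E.
Qed.

(** * Functions constant along curves *)

Lemma is_derive_comp_diff (R : realType) (F dF : R * R * R -> R) (X : R -> R * R * R)
    (t : R) (v : R * R * R) :
  is_diff (X t) F dF -> is_derive t 1 X v -> is_derive t 1 (F \o X) (dF v).
Proof.
move=> hF hX.
have dX : differentiable X t by apply/derivable1_diffP; exact: ex_derive.
have diffX : is_diff t X ( *:%R^~ v).
  by apply: DiffDef => //; rewrite diff1E// derive1E derive_val.
have h := is_diff_comp diffX hF.
apply: DeriveDef; first by apply: diff_derivable; exact: ex_diff.
by rewrite deriveE; [rewrite diff_val /= scale1r|exact: ex_diff].
Qed.

Lemma is_derive0_itv_cst (R : realType) (h : R -> R) (a b : R) :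
  (forall t, t \in `]a, b[ -> is_derive t 1 h 0) -> {in `]a, b[ &, forall t u, h t = h u}.
Proof.
move=> dh; suff H t u : t \in `]a, b[ -> u \in `]a, b[ -> t < u -> h t = h u.
  move=> t u ta ub; have [tu|ut|->//] := ltgtP t u; first exact: H.
  by apply/esym; exact: H.
rewrite !in_itv/= => /andP[at_ tb] /andP[au ub] tu.
have sub z : t <= z <= u -> z \in `]a, b[.
  by move=> /andP[tz zu]; rewrite in_itv/= (lt_le_trans at_)// (le_lt_trans zu).
have D z : z \in `]t, u[ -> is_derive z 1 h ((fun=> 0) z).
  by move=> /[!in_itv]/= /andP[tz zu]; apply: dh; apply: sub; rewrite !ltW.
have C : {within `[t, u], continuous h}.
  apply: continuous_in_subspaceT => z; rewrite inE/= in_itv/= => /sub/dh dz.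
  by apply: differentiable_continuous; apply/derivable1_diffP; exact: ex_derive.
have [z _ e] := @MVT R h (fun=> 0) t u tu D C.
by apply/esym/eqP; rewrite -subr_eq0 e mul0r.
Qed.

(** * The polytropic model *)

Section polytrope_model.
Variables (R : realType) (k : R).
Local Notation mu := (@lebesgue_measure R).
Local Notation M := (measurableTypeR R).
Local Notation E := (R * R * R)%type.
Hypothesis k1 : -1 < k.
Local Notation n := (k + 3 / 2).
Variables (G : R -> R) (s : R).
Hypotheses (s0 : 0 < s) (cG : continuous G) (G01 : forall q, 0 <= G q <= 1)
  (dG : {homo G : q r / q <= r >-> r <= q}) (Gz : forall q, 1 <= q -> G q = 0)
  (G01' : G 0 = 1) (sV : s * volterra G 1 = 1)
  (GE : forall q, q <= 1 -> G q = pos_pow (1 - s * volterra G q) n).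

Let G0 q : 0 <= G q. Proof. by have /andP[] := G01 q. Qed.
Let G1 q : G q <= 1. Proof. by have /andP[] := G01 q. Qed.
Let mG : measurable_fun [set: R] G. Proof. exact: continuous_measurable_fun. Qed.

Lemma integral_radial_compact (h : R -> R) (c : R) : measurable_fun [set: R] h ->
  (forall q, 0 <= h q <= c) -> (forall q, 1 <= q -> h q = 0) ->
  (\int[leb3 R]_y (h (sqn y))%:E = (2 * pi * \int[mu]_(q in `[0, 1]) (Num.sqrt q * h q))%:E)%E.
Proof.
move=> mh hc hz; have h0 q : 0 <= h q by have /andP[] := hc q.
rewrite [LHS](ge0_integral_radial mh h0) [RHS]EFinM; congr (_ * _)%E.
have ih : mu.-integrable `[0, 1] (EFin \o (fun q => Num.sqrt q * h q)).
  apply: (@bounded_itv_integrable _ _ _ _ c).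
    by apply: measurable_funM => //; apply: continuous_measurable_fun; exact: sqrt_continuous.
  move=> q; rewrite ger0_norm ?mulr_ge0 ?sqrtr_ge0//.
  have [q1|q1] := leP 1 q; first by rewrite hz// mulr0; have /andP[] := hc 0; exact: le_trans.
  have /andP[_ hq] := hc q.
  rewrite -[leRHS]mul1r ler_pM ?sqrtr_ge0//.
  by rewrite -[leRHS]sqrtr1 ler_wsqrtr// ltW.
rewrite /Rintegral fineK; last exact: integrable_fin_num.
rewrite [LHS]integral_mkcond [RHS]integral_mkcond; apply: eq_integral => q _.
rewrite !patchE !mem_setE !in_itv/= andbT; have [q0|//] := leP 0 q.
by have [q1|q1] //= := leP q 1; rewrite hz ?mulr0// ltW.
Qed.

(** G is positive near 0 since G 0 = 1, and the lower bound on the field strength turns this into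
    positive mass of a small ball. *)
Lemma mass_gt0 : 0 < mass G 1.
Proof.
have G0pos : \forall q \near (0 : R)^'+, 0 < G q.
  have : G q @[q --> 0^'+] --> G 0 by apply: cvg_at_right_filter; exact: cG.
  by move/cvgr_gt; apply; rewrite G01'.
near (0 : R)^'+ => Q.
have GQ : 0 < G Q by near: Q.
have Q0 : 0 < Q by near: Q; exact: nbhs_right_gt.
have Q1 : Q < 1 by near: Q; exact: nbhs_right_lt.
have /andP[h _] := field_strength_bounds cG dG Q0.
have : 0 < field_strength G Q by rewrite (lt_le_trans _ h)// divr_gt0.
rewrite /field_strength pmulr_lgt0 ?invr_gt0 ?mulr_gt0 ?sqrtr_gt0// => /lt_le_trans; apply.
apply: le_Rintegral_subset => //.
- by move=> q /=; rewrite !in_itv/= => /andP[-> qQ]; rewrite (le_trans qQ)// ltW.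
- apply: continuous_compact_integrable; first exact: segment_compact.
  apply: continuous_subspaceT => q; apply: cvgM; [exact: sqrt_continuous|exact: cG].
- by move=> q _; rewrite mulr_ge0// sqrtr_ge0.
Unshelve. all: by end_near. Qed.

(** The scale that gives [model_density] total mass one; it is the value at the origin because G 0 =
    1. *)
Definition central_density : R := (2 * pi * mass G 1)^-1.
Local Notation beta := central_density.

Lemma central_density_gt0 : 0 < beta.
Proof. by rewrite invr_gt0 !mulr_gt0 ?pi_gt0// mass_gt0. Qed.
Let b0 := central_density_gt0.
Let bG q : 0 <= beta * G q <= beta.
Proof. by rewrite mulr_ge0 ?(ltW b0)//= ger_pMr. Qed.

Definition model_density (x : E) : R := beta * G (sqn x).
Local Notation rho := model_density.
Local Notation U := (potential rho).

Lemma potential_radial : U =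
  radial_field G (- (2 * pi * beta * \int[mu]_(q in `[0, 1]) G q)) (2 * pi * beta).
Proof.
apply/funext => x; rewrite /potential /radial_field [in LHS]/Rintegral.
have -> : (\int[leb3 R]_y (rho y / enorm (x - y))%:E = beta%:E * newton_integral G x)%E.
  rewrite /newton_integral -ge0_integralZl_EFin ?ltW//.
  - by apply: eq_integral => y _; rewrite -EFinM mulrA.
  - by move=> y _; rewrite lee_fin divr_ge0// sqrtr_ge0.
  - by apply/measurable_EFinP; exact: measurable_newton_integrand.
by rewrite newton_integral_volterra// -EFinM [fine _]/=; ring.
Qed.

Let mass_ext (h : R -> R) (Q : R) : 1 <= Q -> (forall q, 1 <= q -> h q = 0) ->
  \int[mu]_(q in `[0, Q]) h q = \int[mu]_(q in `[0, 1]) h q.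
Proof.
move=> Q1 hz; rewrite /Rintegral [in LHS]integral_mkcond [in RHS]integral_mkcond.
congr fine; apply: eq_integral => q _; rewrite !patchE !mem_setE !in_itv/=.
have [q0|//] := leP 0 q; have [q1|q1] /= := leP q 1; first by rewrite (le_trans q1).
by rewrite hz ?if_same// ltW.
Qed.

Let b_mass : 2 * pi * beta * mass G 1 = 1.
Proof. by rewrite /central_density mulrAC divff// gt_eqF// !mulr_gt0 ?pi_gt0// mass_gt0. Qed.

(** Beyond the support the integral of G cancels against the central value, and mass one remains. At
    |x| = 1 the value is -1, the cut-off energy. *)
Lemma potential_outside (x : E) : 1 <= enorm x -> U x = - (enorm x)^-1.
Proof.
move=> x1; have Q1 : 1 <= sqn x by rewrite -[leLHS]sqrtr1 ler_sqrt ?ltr01// ?sqn_ge0// in x1 *.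
rewrite potential_radial /radial_field volterraE// mass_ext//.
have -> : mass G (sqn x) = mass G 1 by apply: mass_ext => // q q1; rewrite Gz ?mulr0.
transitivity (- (enorm x)^-1 * (2 * pi * beta * mass G 1)); last by rewrite b_mass mulr1.
by rewrite /enorm -/(sqn x); ring.
Qed.

Let potential1 : - (2 * pi * beta * \int[mu]_(q in `[0, 1]) G q) + 2 * pi * beta * s^-1 = -1.
Proof.
have -> : s^-1 = volterra G 1 by apply: (mulfI (lt0r_neq0 s0)); rewrite sV divff// gt_eqF.
transitivity (- (2 * pi * beta * mass G 1)); last by rewrite b_mass.
by rewrite volterraE// sqrtr1 invr1 mul1r; ring.
Qed.

(* The value of [-1 - U] at the origin. *)
Definition central_depth : R := 2 * pi * beta / s.
Local Notation alpha := central_depth.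

Lemma central_depth_gt0 : 0 < alpha.
Proof. by rewrite divr_gt0// !mulr_gt0// pi_gt0. Qed.
Let a0 := central_depth_gt0.

(** Inside the ball [potential1] rewrites -1 - U as alpha times 1 - s V, to which the Lane-Emden
    equation applies. Outside, -1 - U = 1 / |x| - 1 is nonpositive and both sides vanish. *)
Lemma pos_pow_potential (x : E) : pos_pow (-1 - U x) n = alpha `^ n * G (sqn x).
Proof.
have [x1|x1] := leP (sqn x) 1.
  rewrite GE// -pos_powM//; congr pos_pow.
  rewrite -{1}potential1 potential_radial /radial_field /central_depth; field.
  by rewrite gt_eqF.
rewrite (Gz (ltW x1)) mulr0.
have e1 : 1 <= enorm x by rewrite /enorm -[leLHS]sqrtr1 ler_wsqrtr// ltW.
rewrite pos_pow_le0// potential_outside// opprK addrC subr_le0 invf_le1//.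
exact: lt_le_trans e1.
Qed.

(** The ratio of the density beta G to the velocity integral c_k alpha^n G of the polytrope with
    amplitude one. *)
Definition steady_amplitude : R := beta / (alpha `^ n * fine (polytropic_constant k)).
Local Notation A := steady_amplitude.

Let c := fine (polytropic_constant k).
Let cE : polytropic_constant k = c%:E.
Proof.
rewrite /c fineK// ge0_fin_numE ?polytropic_constant_lty//.
by rewrite ltW// polytropic_constant_gt0.
Qed.
Let c0 : 0 < c. Proof. by rewrite -lte_fin -cE polytropic_constant_gt0. Qed.
Let an0 : 0 < alpha `^ n. Proof. by rewrite powR_gt0. Qed.

Lemma steady_amplitude_gt0 : 0 < A. Proof. by rewrite divr_gt0// mulr_gt0. Qed.

Lemma integral_model_polytrope (x : E) :
  (\int[leb3 R]_v (polytrope k U x v)%:E = (A^-1 * rho x)%:E)%E.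
Proof.
transitivity (\int[leb3 R]_v (pos_pow ((-1 - U x) - 2^-1 * enorm v ^+ 2) k)%:E)%E.
  by apply: eq_integral => v _; congr (EFin (pos_pow _ _)); ring.
rewrite integral_polytrope// pos_pow_potential cE -EFinM; congr EFin.
rewrite /steady_amplitude /model_density -/c; field.
by rewrite !gt_eqF.
Qed.

Let integral_ball (h : E -> \bar R) : (forall x, 1 <= enorm x -> h x = 0%E) ->
  (\int[leb3 R]_(x in unit_ball3 (R := R)) h x = \int[leb3 R]_x h x)%E.
Proof.
move=> hz; rewrite [LHS]integral_mkcond; apply: eq_integral => x _; rewrite patchE.
by case: ifPn => //; rewrite notin_setE /unit_ball3 /= => /negP; rewrite -leNgt => /hz ->.
Qed.

Lemma model_density_outside (x : E) : 1 <= enorm x -> rho x = 0.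
Proof.
move=> x1; rewrite /model_density Gz ?mulr0//.
by rewrite -[leLHS]sqrtr1 ler_sqrt ?sqn_ge0// in x1.
Qed.

Lemma model_mass : (\int[leb3 R]_(x in unit_ball3 (R := R)) (rho x)%:E = 1)%E.
Proof.
rewrite integral_ball; last by move=> x x1; rewrite model_density_outside.
rewrite (@integral_radial_compact (fun q => beta * G q) beta).
- transitivity (2 * pi * beta * mass G 1)%:E; last by rewrite b_mass.
  congr EFin; rewrite -!mulrA; congr (_ * (_ * _)); rewrite /mass -RintegralZl//.
    by apply: eq_Rintegral => q _; ring.
  apply: continuous_compact_integrable; first exact: segment_compact.
  apply: continuous_subspaceT => q; apply: cvgM; [exact: sqrt_continuous|exact: cG].
- exact: measurable_funM.
- exact: bG.
- by move=> q q1; rewrite Gz ?mulr0.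
Qed.

Lemma measurable_model_density :
  measurable_fun [set: M * M * M] (rho : M * M * M -> R).
Proof.
by apply: measurable_funM => //; apply: (measurableT_comp mG); exact: measurable_sqnorm3.
Qed.

Lemma model_density_Lfun (p : R) : 0 < p -> rho \in Lfun (leb3 R) p%:E.
Proof.
move=> p0; rewrite inE; apply/andP; split; rewrite inE/=.
  exact: measurable_model_density.
rewrite /finite_norm unlock /=; apply: poweR_lty.
rewrite (_ : (\int[_]_x _)%E = (\int[leb3 R]_x (((beta * G (sqn x)) `^ p)%:E))%E); last first.
  apply: eq_integral => x _ /=; congr (EFin (_ `^ _)).
  by rewrite ger0_norm// /model_density mulr_ge0// ltW.
rewrite (@integral_radial_compact (fun q => (beta * G q) `^ p) (beta `^ p)) ?ltry//.
- apply: (measurableT_comp (measurable_powR p)); exact: measurable_funM.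
- move=> q; have /andP[bG0 bG1] := bG q.
  by rewrite powR_ge0/= ge0_ler_powR ?nnegrE// ltW.
- by move=> q q1; rewrite Gz ?mulr0 ?powR0// gt_eqF.
Qed.

Lemma model_density_densities (p : R) : 0 < p -> densities p rho.
Proof.
move=> p0; split.
- exact: model_density_Lfun.
- by move=> x /negP; rewrite -leNgt; exact: model_density_outside.
- by apply: aeW => x; rewrite mulr_ge0// ltW.
- exists (fun r => beta * G (r ^+ 2)); split.
    move=> r t; rewrite !in_itv/= => /andP[r0 _] /andP[t0 _] rt.
    rewrite ler_pM2l//; apply: dG.
    by rewrite ler_sqr ?nnegrE//; exact: ltW.
  by apply: aeW => x _; rewrite /enorm sqr_sqrtr ?sqn_ge0.
- exact: model_mass.
Qed.

Lemma induced_model_density (x : E) : induced_density k rho x = A^-1 * rho x.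
Proof. by rewrite /induced_density /Rintegral integral_model_polytrope. Qed.

(** The induced density is already proportional to [model_density], which has mass one; the
    normalising integral is thus the factor A^-1 itself and cancels. *)
Lemma T_op_model_density : T_op k rho = rho.
Proof.
have A0 := steady_amplitude_gt0.
apply/funext => x; rewrite /T_op induced_model_density.
have -> : \int[leb3 R]_(y in unit_ball3 (R := R)) induced_density k rho y = A^-1.
  have -> : A^-1 = fine (A^-1%:E * \int[leb3 R]_y (rho y)%:E)%E.
    by rewrite -integral_ball ?model_mass ?mule1// => y y1; rewrite model_density_outside.
  rewrite -ge0_integralZl_EFin//.
  - rewrite /Rintegral integral_ball; last first.
      by move=> y y1; rewrite induced_model_density model_density_outside// mulr0.
    by congr fine; apply: eq_integral => y _; rewrite induced_model_density.
  - by move=> y _; rewrite lee_fin; have /andP[] := bG (sqn y).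
  - by apply/measurable_EFinP; exact: measurable_model_density.
  - by rewrite invr_ge0 ltW.
by rewrite invrK mulVKf// gt_eqF.
Qed.

Lemma energy_conserved (a b : R) (X V : R -> E) : characteristic U a b X V ->
  {in `]a, b[ &, forall t u, particle_energy U (X t) (V t) = particle_energy U (X u) (V u)}.
Proof.
move=> XV; pose h t := 2^-1 * sqn (V t) + U (X t).
have hE t : particle_energy U (X t) (V t) = h t.
  by rewrite /particle_energy /enorm sqr_sqrtr ?sqn_ge0.
have dh t : t \in `]a, b[ -> is_derive t 1 h 0.
  move=> /XV[dX dV].
  have d1 := is_derive_comp_diff (is_diff_sqn (V t)) dV.
  have d2 := is_derive_comp_diff (is_diff_radial_field cG G0 G1
    (- (2 * pi * beta * \int[mu]_(q in `[0, 1]) G q)) (2 * pi * beta) (X t)) dX.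
  rewrite -potential_radial in d2.
  (* The kinetic term contributes V . V' = - V . grad U and the potential term grad U . V. The chain
     rule is legitimate at the origin too, since U is differentiable everywhere. *)
  apply: (is_derive_eq (is_deriveD (is_deriveZ 2^-1 d1) d2)).
  rewrite /gradient potential_radial !derive_radial_field//.
  by rewrite /GRing.scale /coord1 /coord2 /coord3 /=; field.
by move=> t u ta ub; rewrite !hE; exact: (is_derive0_itv_cst dh).
Qed.

Lemma model_steady_state :
  steady_state (fun x v => A * pos_pow (-1 - 1 / 2 * enorm v ^+ 2 - U x) k) rho U.
Proof.
pose Phi e := A * pos_pow (-1 - e) k.
have fE x v : A * pos_pow (-1 - 1 / 2 * enorm v ^+ 2 - U x) k = Phi (particle_energy U x v).
  by rewrite /Phi /particle_energy div1r opprD addrA.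
have A0 := steady_amplitude_gt0.
split; first by exists Phi.
- move=> a b X V XV t u ta ub.
  apply: (etrans (fE _ _)); apply: (etrans _ (esym (fE _ _))).
  by congr Phi; exact: (energy_conserved XV).
- move=> x; transitivity (A%:E * \int[leb3 R]_v (polytrope k U x v)%:E)%E; last first.
    by rewrite integral_model_polytrope -EFinM mulVKf// gt_eqF.
  have mp : measurable_fun [set: M * M * M] (fun v : M * M * M => polytrope k U x v : M).
    apply: (measurableT_comp (measurable_pos_pow k)).
    apply: measurable_funB; last exact: measurable_cst.
    apply: measurable_funB; first exact: measurable_cst.
    apply: measurable_funM; first exact: measurable_cst.
    by apply: measurable_funX; exact: measurable_enorm.
  have mpE : measurable_fun [set: M * M * M] (EFin \o (fun v : M * M * M => polytrope k U x v : M)).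
    exact/measurable_EFinP.
  have p0 (v : M * M * M) : setT v -> (0 <= (polytrope k U x v)%:E)%E.
    by move=> _; rewrite lee_fin pos_pow_ge0.
  apply: (etrans _ (ge0_integralZl_EFin (leb3 R) (measurableT) p0 mpE (ltW A0))).
  by apply: eq_integral => v _; rewrite /polytrope div1r EFinM.
- by [].
- split.
  + by rewrite potential_radial; exact: twice_differentiable_radial_field.
  + move=> x; rewrite potential_radial laplacian_radial_field// /model_density; ring.
  (* Beyond radius 1 the potential is exactly -1 / |x|, which is smaller than e in modulus beyond 1
     / e. *)
  + move=> e e0; exists (Num.max 1 e^-1) => x; rewrite gt_max => /andP[x1 xe].
    have x0 : 0 < enorm x by rewrite (lt_trans _ x1).
    rewrite potential_outside ?ltW// normrN gtr0_norm ?invr_gt0//.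
    by rewrite invf_plt ?posrE.
Qed.

End polytrope_model.

Theorem theorem5p2 (R : realType) (p k : R)
    (hp : 3 / 2 < p) (hk : -1 < k) (hk' : k < 1 / 2) :
  (exists rho : R * R * R -> R, densities p rho /\
     {ae leb3 R, forall x, unit_ball3 x -> T_op k rho x = rho x})
  /\
  (exists (A : R) (rho : R * R * R -> R),
     [/\ 0 < A, densities p rho &
       let U := potential rho in
       let f := fun x v => A * pos_pow (-1 - 1 / 2 * enorm v ^+ 2 - U x) k in
       steady_state f rho U]).
Proof.
have p0 : 0 < p by lra.
(* The bounds on k give 0 < n, for continuity of the power, and n < 2, for the existence of a
   zero. *)
have [||G [s [s0 cG G01 dG [Gz G1 sV GE]]]] := @lane_emden_density R (k + 3 / 2); [lra|lra|].
pose rho := model_density G.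
split; first (exists rho; split).
- exact: (model_density_densities cG G01 dG Gz G1 p0).
- by apply: aeW => x _; rewrite /rho (T_op_model_density hk s0 cG G01 dG Gz G1 sV GE).
exists (steady_amplitude k G s), rho; split.
- exact: (steady_amplitude_gt0 hk s0 cG G01 dG G1).
- exact: (model_density_densities cG G01 dG Gz G1 p0).
- exact: (model_steady_state hk s0 cG G01 dG Gz G1 sV GE).
Qed.
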